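(* Let $\underline{\mathbf q}_2^*=(\underline q_{1,2}^*,\dots,\underline q_{N_f,2}^* )$ be the caching probability that maximizes the lower bound $\underline P_{\rm off}$ (defined in the context) of the successful offloading probability subject to $\sum_{f=1}^{N_f}q_{f,2}\le N_c$ and $0\le q_{f,2}\le1$ for all $f$. Then for any $f$ with $\underline q_{f,2}^*,\underline q_{f+1,2}^*\in(0,1)$, the difference $\underline q_{f,2}^*-\underline q_{f+1,2}^*$ increases with $\lambda_u/\lambda_2$. That is, with all other parameters (including $\lambda_{12}$) fixed, on the set of values of $\lambda_u/\lambda_2\in(0,\infty)$ for which both $\underline q_{f,2}^*$ and $\underline q_{f+1,2}^*$ lie in $(0,1)$, $\underline q_{f,2}^*-\underline q_{f+1,2}^*$ is an increasing function of $\lambda_u/\lambda_2$.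
   Context: $[x]_0^1=\max\{\min\{x,1\},0\}$. Parameters: user-to-helper density ratio $\lambda_u/\lambda_2>0$, $\lambda_{12}>0$ (ratio of macro-BS density to helper density), $P_{12}>0$ (ratio of transmit powers), $B_{12}>0$ (ratio of association bias factors), $\gamma_0>0$, $\alpha>2$, integer $M_1\ge1$, $M_2=1$, $M_{12}=M_1/M_2$. $N_f$ is the number of files, $N_c$ is the cache capacity, a positive integer with $N_c\le N_f$, and $p_f=f^{-\delta}/\sum_{n=1}^{N_f}n^{-\delta}$ with $\delta>0$. ${}_2F_1$ is the Gauss hypergeometric function (analytically continued to the negative real axis), $\Gamma$ the Gamma function, and $$\mathcal C_{1,\gamma_0}=\lambda_{12}(P_{12}B_{12})^{2/\alpha}\,{}_2F_1\Big[-\tfrac2\alpha,M_1;1-\tfrac2\alpha;-\tfrac{\gamma_0}{M_{12}B_{12}}\Big],\quad \mathcal C_{2,\gamma_0}=\frac{\Gamma(1-\frac2\alpha)\Gamma(M_2+\frac2\alpha)}{\Gamma(M_2)}\gamma_0^{2/\alpha},$$ $$\mathcal C_{3,\gamma_0}={}_2F_1\Big[-\tfrac2\alpha,M_2;1-\tfrac2\alpha;-\gamma_0\Big]-\mathcal C_{2,\gamma_0}-1.$$ Define $$q_{f,2}^o=\left[\sqrt{\frac{\lambda_{12}(P_{12}B_{12})^{2/\alpha}}{\mu}}\,\sqrt{p_f}-\lambda_{12}(P_{12}B_{12})^{2/\alpha}\right]_0^1$$ with $\mu>0$ such that $\sum_{f=1}^{N_f}q_{f,2}^o=N_c$, then $$\bar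 p_{{\rm a},2}=1-\bigg(1+\frac{\lambda_u}{3.5\lambda_2}\sum_{f=1}^{N_f}\frac{p_fq_{f,2}^o}{\lambda_{12}(P_{12}B_{12})^{2/\alpha}+q_{f,2}^o}\bigg)^{-3.5},$$ and $$\underline P_{\rm off}(\mathbf q_2)=\sum_{f=1}^{N_f}\frac{p_f\,q_{f,2}}{\mathcal C_{1,\gamma_0}+\bar p_{{\rm a},2}\mathcal C_{2,\gamma_0}+(\bar p_{{\rm a},2}\mathcal C_{3,\gamma_0}+1)\,q_{f,2}}.$$ The maximizer is given explicitly by $$\underline q_{f,2}^*=\left[\frac{\sqrt{\mathcal C_{1,\gamma_0}+\bar p_{{\rm a},2}\mathcal C_{2,\gamma_0}}}{\sqrt\nu\,(\bar p_{{\rm a},2}\mathcal C_{3,\gamma_0}+1)}\sqrt{p_f}-\frac{\mathcal C_{1,\gamma_0}+\bar p_{{\rm a},2}\mathcal C_{2,\gamma_0}}{\bar p_{{\rm a},2}\mathcal C_{3,\gamma_0}+1}\right]_0^1,$$ with $\nu>0$ such that $\sum_{f=1}^{N_f}\underline q_{f,2}^*=N_c$. *)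

(* Defs.v *)
From mathcomp Require Import all_boot all_order all_algebra.
From mathcomp Require Import all_classical all_reals all_analysis.

Set Implicit Arguments.
Unset Strict Implicit.
Unset Printing Implicit Defensive.

Import Order.TTheory GRing.Theory Num.Theory.
Import numFieldNormedType.Exports.

Local Open Scope classical_set_scope.
Local Open Scope ring_scope.

Section SpecialFunctions.
Context {R : realType}.
Implicit Types (a b c s x z : R) (F : R -> R).

(* Euler's integral; meaningful for 0 < s only. *)
Definition Gamma s : R :=
  \int[lebesgue_measure]_(t in `]0, +oo[) (t `^ (s - 1) * expR (- t)).

Definition rising a (n : nat) : R := \prod_(i < n) (a + i%:R).

(* Coefficients of the Gauss series; meaningful when c is not a nonpositive
   integer. *)
Definition gauss_coef a b c (n : nat) : R :=
  rising a n * rising b n / rising c n / n`!%:R.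

Definition analytic_at F x : Prop :=
  exists (u : R^nat) (r : R), 0 < r /\
    forall h, `|h| < r -> pseries u h @ \oo --> F (x + h).

Definition gauss_continuation a b c F : Prop :=
  (forall z, `|z| < 1 -> pseries (gauss_coef a b c) z @ \oo --> F z) /\
  (forall z, z < 1 -> analytic_at F z).

(* Gauss' 2F1[a, b; c; z] on the real half-line z < 1: the analytic
   continuation of the Gauss series from ]-1, 1[. It is unique on ]-oo, 1[ by
   the identity theorem; the values at z >= 1 are junk. *)
Definition hyp2F1 a b c : R -> R :=
  xget (fun=> 0) [set F | gauss_continuation a b c F].

End SpecialFunctions.

Section Caching.
Context {R : realType}.

(* [x]_0^1 *)
Definition clip01 (x : R) : R := Num.max (Num.min x 1) 0.

(* Files are numbered from 1 to Nf: the ordinal i stands for file i.+1. *)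
Definition zipf (delta : R) (Nf : nat) (i : 'I_Nf) : R :=
  i.+1%:R `^ (- delta) / \sum_(n < Nf) n.+1%:R `^ (- delta).

(* lambda_12 (P_12 B_12)^(2/alpha) *)
Definition macro_weight (alpha lambda12 P12 B12 : R) : R :=
  lambda12 * (P12 * B12) `^ (2 / alpha).

Definition C1 (alpha lambda12 P12 B12 gamma0 : R) (M1 M2 : nat) : R :=
  macro_weight alpha lambda12 P12 B12 *
  hyp2F1 (- (2 / alpha)) M1%:R (1 - 2 / alpha)
    (- (gamma0 / (M1%:R / M2%:R * B12))).

Definition C2 (alpha gamma0 : R) (M2 : nat) : R :=
  Gamma (1 - 2 / alpha) * Gamma (M2%:R + 2 / alpha) / Gamma M2%:R *
  gamma0 `^ (2 / alpha).

Definition C3 (alpha gamma0 : R) (M2 : nat) : R :=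
  hyp2F1 (- (2 / alpha)) M2%:R (1 - 2 / alpha) (- gamma0)
  - C2 alpha gamma0 M2 - 1.

(* The vector q_2^o for a given multiplier mu; k is the macro weight. *)
Definition qo (k delta mu : R) (Nf : nat) : 'rV[R]_Nf :=
  \row_i clip01 (Num.sqrt (k / mu) * Num.sqrt (zipf delta i) - k).

(* Active probability of a helper; rho is the ratio lambda_u / lambda_2. *)
Definition active_prob (k delta : R) (Nf : nat) (q : 'rV[R]_Nf) (rho : R) : R :=
  1 - (1 + rho / (7 / 2) *
         \sum_i zipf delta i * q 0 i / (k + q 0 i)) `^ (- (7 / 2)).

Definition Poff_lb (c1 c2 c3 pa delta : R) (Nf : nat) (q : 'rV[R]_Nf) : R :=
  \sum_i zipf delta i * q 0 i / (c1 + pa * c2 + (pa * c3 + 1) * q 0 i).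

Definition caching_policies (Nf Nc : nat) : set 'rV[R]_Nf :=
  [set q : 'rV[R]_Nf | \sum_i q 0 i <= Nc%:R /\ forall i, 0 <= q 0 i <= 1].

Definition maximizes (T : Type) (A : set T) (P : T -> R) (x : T) : Prop :=
  A x /\ forall y, A y -> P y <= P x.

End Caching.

Arguments caching_policies {R} Nf Nc _.

(* Main.v *)
(* Put theta = 2 / alpha and write the objective, up to a positive factor, as
   sum_f p_f q_f / (t + q_f) with
   t = (C1 + p_a C2) / (p_a C3 + 1). Its maximizer is q_f = clip(c sqrt(p_f) - t),
   so the gap at interior coordinates is c (sqrt(p_f) - sqrt(p_{f+1})), and the
   constraint sum_f q_f = N_c forces c to increase with t. Since p_a increases
   with lambda_u / lambda_2, it remains to see that t increases with p_a, i.e.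
   that C2 > C1 C3. This follows from C1, C2 > 0 and -1 <= C3 <= 0.

   With beta = 1 / (1 - theta), the function 2F1[-theta, M; 1 - theta; z] is
   (1 - z)^(-M) - M beta z int_0^1 (1 - z v^beta)^(-M-1) dv; its values on the
   negative half-line are determined by the Gauss series through the identity
   theorem for real power series. For M = 1 and z = -g, Tonelli's theorem gives
   C2 = g beta int_0^oo (1 + g v^beta)^(-2) dv, the same integral extended to the
   half-line, whose tail beyond 1 is elementary to bound. *)
Require Import Defs.
From mathcomp Require Import all_boot all_order all_algebra.
From mathcomp Require Import ring lra.
From mathcomp Require Import all_classical all_reals all_analysis.
From mathcomp Require Import measurable_realfun.
Import Order.TTheory GRing.Theory Num.Theory.
Import numFieldNormedType.Exports.
Local Open Scope classical_set_scope.
Local Open Scope ring_scope.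

Set Implicit Arguments.
Unset Strict Implicit.
Unset Printing Implicit Defensive.

(** * Maximizers of sum p q / (t + q) *)

Section WaterFilling.
Context {R : realType} (Nf Nc : nat) (p : 'I_Nf -> R).
Hypothesis p_gt0 : forall i, 0 < p i.
Implicit Types (t e : R) (q : 'rV[R]_Nf) (i j : 'I_Nf).

Let obj t q : R := \sum_i p i * q 0 i / (t + q 0 i).

Lemma sum_eq_off1 (F G : 'I_Nf -> R) i :
  (forall l, l != i -> F l = G l) -> \sum_l F l - \sum_l G l = F i - G i.
Proof.
move=> FG; rewrite -sumrB (bigD1 i)//= big1 ?addr0// => l li.
by rewrite FG// subrr.
Qed.

Lemma sum_eq_off2 (F G : 'I_Nf -> R) i j : i != j ->
  (forall l, l != i -> l != j -> F l = G l) ->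
  \sum_l F l - \sum_l G l = (F i - G i) + (F j - G j).
Proof.
move=> ij FG; rewrite -sumrB (bigD1 i)//= (bigD1 j)//=; last by rewrite eq_sym.
rewrite big1 ?addr0// => l /andP[li lj].
by rewrite FG// subrr.
Qed.

(** The exact increment of a summand: its numerator is linear in [e], so the effect of changing one
    or two coordinates can be compared without derivatives. *)
Lemma frac_incr (P t x e : R) : t + x != 0 -> t + x + e != 0 ->
  P * (x + e) / (t + (x + e)) - P * x / (t + x) =
  P * t * e / ((t + x) * (t + x + e)).
Proof. by move=> h1 h2; rewrite addrA; field; rewrite h1 h2. Qed.

(** With slack in the budget, raising the unsaturated coordinate [f] would strictly increase the
    objective. *)
Lemma maximizer_saturates t q f : 0 < t ->
  maximizes (caching_policies Nf Nc) (obj t) q -> q 0 f < 1 ->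
  \sum_i q 0 i = Nc%:R.
Proof.
move=> t0 [[qN q01] qmax] qf1; apply/eqP; rewrite eq_le qN/= leNgt.
apply/negP => qlt.
have /andP[qf0 _] := q01 f.
(* The largest increase of [q 0 f] that respects both the budget and the cap 1. *)
pose e := Num.min (Nc%:R - \sum_i q 0 i) (1 - q 0 f).
have e0 : 0 < e by rewrite lt_min !subr_gt0 qlt.
have e1 : e <= Nc%:R - \sum_i q 0 i by rewrite ge_min lexx.
have e2 : e <= 1 - q 0 f by rewrite ge_min lexx orbT.
pose q' : 'rV[R]_Nf := \row_l (if l == f then q 0 f + e else q 0 l).
have q'f : q' 0 f = q 0 f + e by rewrite mxE eqxx.
have q'n l : l != f -> q' 0 l = q 0 l by move=> /negbTE lf; rewrite mxE lf.
have : obj t q' <= obj t q.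
  apply: qmax; split => [|l]; last first.
    by have [->|lf] := eqVneq l f; [rewrite q'f; lra|rewrite q'n].
  have := @sum_eq_off1 (fun l => q' 0 l) (fun l => q 0 l) f q'n.
  by rewrite q'f; lra.
rewrite -subr_le0 (sum_eq_off1 (i := f)); last by move=> l lf; rewrite q'n.
rewrite q'f frac_incr; [|by lra|by lra].
apply/negP; rewrite -ltNge divr_gt0// ?mulr_gt0//; lra.
Qed.

(** Letting [e] tend to 0 in an inequality with linear error terms yields first-order optimality
    conditions. *)
Lemma le_of_small_perturb (x y a b e0 : R) : 0 < e0 ->
  (forall e, 0 < e -> e <= e0 -> x - a * e <= y + b * e) -> x <= y.
Proof.
move=> e00 H; apply/ler_addgt0Pr => d d0.
pose c := `|a + b| + 1.
have c0 : 0 < c by rewrite ltr_wpDl.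
pose e := Num.min e0 (d / c).
have e_gt0 : 0 < e by rewrite lt_min e00 divr_gt0.
have /H : e <= e0 by rewrite ge_min lexx.
move=> /(_ e_gt0) h.
have ed : e * c <= d by rewrite -ler_pdivlMr// ge_min lexx orbT.
have : (a + b) * e <= c * e.
  by rewrite ler_pM2r// (le_trans (ler_norm _))// lerDl.
lra.
Qed.

(** Moving a mass [e] from [j] to [i] cannot help. After division by [t * e] this says that
    [p i * (t + q 0 j) * (t + q 0 j - e)] is at most [p j * (t + q 0 i) * (t + q 0 i + e)]; then [e]
    tends to 0 and square roots are taken. *)
Lemma maximizer_marginal t q i j : 0 < t ->
  maximizes (caching_policies Nf Nc) (obj t) q -> q 0 i < 1 -> 0 < q 0 j ->
  Num.sqrt (p i) * (t + q 0 j) <= Num.sqrt (p j) * (t + q 0 i).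
Proof.
move=> t0 [[qN q01] qmax] qi1 qj0.
have [->//|ij] := eqVneq i j.
have /andP[qi0 _] := q01 i; have /andP[_ qj1] := q01 j.
rewrite -(@ler_pXn2r _ 2) ?nnegrE//; last 2 first.
  by rewrite mulr_ge0 ?sqrtr_ge0//; lra.
  by rewrite mulr_ge0 ?sqrtr_ge0//; lra.
rewrite !exprMn !sqr_sqrtr; [|exact: ltW|exact: ltW].
(* Up to this threshold the transfer keeps both coordinates in the unit interval. *)
apply: (@le_of_small_perturb _ _ (p i * (t + q 0 j)) (p j * (t + q 0 i))
  (Num.min (1 - q 0 i) (q 0 j))).
  by rewrite lt_min subr_gt0 qi1.
move=> e e0; rewrite le_min => /andP[e1 e2].
pose q' : 'rV[R]_Nf := \row_l (if l == i then q 0 i + e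
  else if l == j then q 0 j - e else q 0 l).
have q'i : q' 0 i = q 0 i + e by rewrite mxE eqxx.
have q'j : q' 0 j = q 0 j + (- e) by rewrite mxE eq_sym (negbTE ij) eqxx.
have q'n l : l != i -> l != j -> q' 0 l = q 0 l.
  by move=> /negbTE li /negbTE lj; rewrite mxE li lj.
have : obj t q' <= obj t q.
  apply: qmax; split => [|l]; last first.
    have [->|li] := eqVneq l i; first by rewrite q'i; lra.
    by have [->|lj] := eqVneq l j; [rewrite q'j; lra|rewrite q'n].
  have := @sum_eq_off2 (fun l => q' 0 l) (fun l => q 0 l) i j ij q'n.
  by rewrite q'i q'j; lra.
rewrite -subr_le0 (@sum_eq_off2 _ _ i j ij); last by move=> l li lj; rewrite q'n.
rewrite q'i q'j !frac_incr; [|by lra|by lra|by lra|by lra].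
rewrite mulrN mulNr subr_le0 -!mulrA ![_ * (t * _)]mulrCA ler_pM2l//.
rewrite ![_ * (e * _)]mulrCA ler_pM2l//.
rewrite ler_pdivrMr ?mulr_gt0//; [|by lra|by lra].
rewrite mulrAC ler_pdivlMr ?mulr_gt0//; [|by lra|by lra].
lra.
Qed.

(* At an interior coordinate [f], the multiplier is [c = (t + q_f) / sqrt p_f],
   and every coordinate is [c * sqrt p_i - t] clipped to [0, 1]. If [c] did not
   increase with [t], all coordinates would weakly decrease and [q_f] strictly,
   contradicting saturation of the constraint. *)
Lemma maximizer_gap_increasing t1 t2 q1 q2 f f' :
  0 < t1 -> t1 < t2 -> p f' < p f ->
  maximizes (caching_policies Nf Nc) (obj t1) q1 ->
  maximizes (caching_policies Nf Nc) (obj t2) q2 ->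
  0 < q1 0 f < 1 -> 0 < q1 0 f' < 1 -> 0 < q2 0 f < 1 -> 0 < q2 0 f' < 1 ->
  q1 0 f - q1 0 f' < q2 0 f - q2 0 f'.
Proof.
move=> t10 t12 pff' max1 max2 /andP[q1f0 q1f1] /andP[q1f'0 q1f'1]
  /andP[q2f0 q2f1] /andP[q2f'0 q2f'1].
have t20 : 0 < t2 by lra.
pose r i := Num.sqrt (p i).
have r0 i : 0 < r i by rewrite sqrtr_gt0.
have rff' : r f' < r f by rewrite ltr_sqrt.
pose c1 := (t1 + q1 0 f) / r f; pose c2 := (t2 + q2 0 f) / r f.
have up1 i : q1 0 i < 1 -> r i * c1 - t1 <= q1 0 i.
  move=> h; have := maximizer_marginal t10 max1 h q1f0.
  by rewrite lerBlDl mulrA ler_pdivrMr// [leRHS]mulrC.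
have up2 i : q2 0 i < 1 -> r i * c2 - t2 <= q2 0 i.
  move=> h; have := maximizer_marginal t20 max2 h q2f0.
  by rewrite lerBlDl mulrA ler_pdivrMr// [leRHS]mulrC.
have lo1 i : 0 < q1 0 i -> q1 0 i <= r i * c1 - t1.
  move=> h; have := maximizer_marginal t10 max1 q1f1 h.
  by rewrite lerBrDl mulrA ler_pdivlMr// [leLHS]mulrC.
have lo2 i : 0 < q2 0 i -> q2 0 i <= r i * c2 - t2.
  move=> h; have := maximizer_marginal t20 max2 q2f1 h.
  by rewrite lerBrDl mulrA ler_pdivlMr// [leLHS]mulrC.
(* At [f] and [f'] the clipping is inactive, so each gap is [r f - r f'] times its multiplier. *)
suff c12 : c1 < c2.
  have := up1 _ q1f1; have := lo1 _ q1f0; have := up1 _ q1f'1.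
  have := lo1 _ q1f'0; have := up2 _ q2f1; have := lo2 _ q2f0.
  have := up2 _ q2f'1; have := lo2 _ q2f'0.
  have : 0 < (r f - r f') * (c2 - c1) by rewrite mulr_gt0// subr_gt0.
  lra.
rewrite ltNge; apply/negP => c21.
have below i : r i * c2 - t2 < r i * c1 - t1.
  by have : r i * c2 <= r i * c1 by [rewrite ler_pM2l]; lra.
have q21 i : q2 0 i <= q1 0 i.
  (* Otherwise [q2 0 i > 0] and [q1 0 i < 1], so [lo2] and [up1] apply and contradict [below]. *)
  rewrite leNgt; apply/negP => q12.
  have /andP[q1i0 _] := max1.1.2 i; have /andP[_ q2i1] := max2.1.2 i.
  have := lo2 i (le_lt_trans q1i0 q12); have := up1 i (lt_le_trans q12 q2i1).
  have := below i; lra.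
have : \sum_i q2 0 i < \sum_i q1 0 i.
  rewrite (bigD1 f)//= [ltRHS](bigD1 f)//= ltr_leD//; last first.
    by apply: ler_sum => i _; exact: q21.
  have := lo2 _ q2f0; have := up1 _ q1f1; have := below f; lra.
by rewrite (maximizer_saturates t10 max1 q1f1)
  (maximizer_saturates t20 max2 q2f1) ltxx.
Qed.

End WaterFilling.

(** * Uniqueness of analytic continuation *)

Section PowerSeries.
Context {R : realType}.
Implicit Types (u v : R^nat) (h r x : R).

Lemma pseriesS u h n :
  pseries u h n.+1 = u 0%N + h * pseries (fun i => u i.+1) h n.
Proof.
rewrite /pseries/= /series/= big_nat_recl// expr0 mulr1 mulr_sumr; congr (_ + _).
by apply: eq_bigr => i _; rewrite exprS mulrCA.
Qed.

(** Removing the head and dividing by [h] carries vanishing from one coefficient to the next. *)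
Lemma cvg_pseries_shift u h l : h != 0 ->
  pseries u h @ \oo --> l ->
  pseries (fun i => u i.+1) h @ \oo --> (l - u 0%N) / h.
Proof.
move=> h0 ul.
have -> : pseries (fun i => u i.+1) h =
    (fun n => (pseries u h n.+1 - u 0%N) / h).
  by apply/funext => n; rewrite pseriesS addrC addKr mulrC mulKf.
apply: cvgMr_tmp; apply: cvgB; last exact: cvg_cst.
by rewrite (cvg_shiftS (pseries u h)).
Qed.

(** The tail of the series is at most [h * B] in absolute value, with [B] independent of [h], so the
    head is arbitrarily small. Only positive [h] occur because agreement of two functions will be
    known on one side of a point only. *)
Lemma pseries_head_eq0 u r : 0 < r ->
  (forall h, 0 < h -> h < r -> pseries u h @ \oo --> 0) -> u 0%N = 0.
Proof.
(* The shifted series converges at [h0], hence absolutely at the smaller point [h1]; the absolute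
   sum there is [B]. *)
move=> r0 u0; pose h0 := r / 2; pose h1 := h0 / 2.
have h00 : 0 < h0 by rewrite /h0; lra.
have h0r : h0 < r by rewrite /h0; lra.
have h10 : 0 < h1 by rewrite /h1; lra.
have h1h0 : h1 < h0 by rewrite /h1; lra.
pose v i := u i.+1.
have cv : cvgn (pseries (fun i => `|v i|) h1).
  apply: (@is_cvg_pseries_inside_norm _ _ h0); last by rewrite !gtr0_norm.
  by apply/cvg_ex; eexists; apply: cvg_pseries_shift (u0 _ h00 h0r); rewrite gt_eqF.
pose B := limn (pseries (fun i => `|v i|) h1).
have vB h n : 0 < h -> h <= h1 -> `|pseries v h n| <= B.
  move=> hp hh1; apply: (@le_trans _ _ (pseries (fun i => `|v i|) h1 n)).
    rewrite /pseries/= /series/=; apply: (le_trans (ler_norm_sum _ _ _)).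
    apply: ler_sum => i _; rewrite normrM ler_wpM2l// normrX (gtr0_norm hp).
    by rewrite lerXn2r// nnegrE ltW.
  apply: nondecreasing_cvgn_le => //; apply: nondecreasing_series => i _ _.
  by rewrite mulr_ge0// exprn_ge0// ltW.
have B0 : 0 <= B by exact: le_trans (vB h1 0%N h10 (lexx _)).
apply/eqP; rewrite -normr_le0; apply/ler_addgt0Pr => e e0; rewrite add0r.
pose h := Num.min h1 (e / (B + 1)).
have hp : 0 < h by rewrite lt_min h10 divr_gt0// ltr_wpDl.
have hh1 : h <= h1 by rewrite ge_min lexx.
have he : h * (B + 1) <= e.
  by rewrite -ler_pdivlMr ?ltr_wpDl// ge_min lexx orbT.
have hB : h * B <= e by lra.
have ch : (fun n => `|pseries u h n.+1 - u 0%N|) @ \oo --> `|0 - u 0%N|.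
  apply: cvg_norm; apply: cvgB; last exact: cvg_cst.
  rewrite (cvg_shiftS (pseries u h)); apply: u0 => //; lra.
rewrite -normrN -[X in `|X|]add0r -(cvg_lim _ ch)//.
apply: limr_le; first by apply/cvg_ex; eexists; exact: ch.
apply: nearW => n; apply: le_trans hB.
by rewrite pseriesS addrC addKr normrM (gtr0_norm hp) ler_pM2l// vB.
Qed.

Lemma pseries_eq0 u r : 0 < r ->
  (forall h, 0 < h -> h < r -> pseries u h @ \oo --> 0) ->
  forall n, u n = 0.
Proof.
move=> r0 + n; elim: n u => [|n IH] u u0; first exact: pseries_head_eq0 u0.
apply: (IH (fun i => u i.+1)) => h h0 hr.
have := cvg_pseries_shift (lt0r_neq0 h0) (u0 _ h0 hr).
by rewrite (pseries_head_eq0 r0 u0) subrr mul0r.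
Qed.

Lemma cvg_pseriesB u v h k l : pseries u h @ \oo --> k ->
  pseries v h @ \oo --> l -> pseries (fun i => u i - v i) h @ \oo --> k - l.
Proof.
move=> uk vl.
have -> : pseries (fun i => u i - v i) h =
    (fun n => pseries u h n - pseries v h n).
  apply/funext => n; rewrite /pseries/= /series/= -sumrB.
  by apply: eq_bigr => i _; rewrite mulrBl.
exact: cvgB.
Qed.

(** Agreement to the right of [x] forces equal Taylor coefficients, hence agreement on both
    sides. *)
Lemma analytic_identity (F G : R -> R) x e : 0 < e ->
  analytic_at F x -> analytic_at G x ->
  (forall h, 0 < h -> h < e -> F (x + h) = G (x + h)) ->
  exists2 r, 0 < r & forall h, `|h| < r -> F (x + h) = G (x + h).
Proof.
move=> e0 [u [r1 [r10 uF]]] [v [r2 [r20 vG]]] FG.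
pose r := Num.min r1 r2.
have r0 : 0 < r by rewrite lt_min r10.
exists r => // h; rewrite lt_min => /andP[h1 h2].
have uv n : u n = v n.
  apply/eqP; rewrite -subr_eq0; apply/eqP; move: n.
  apply: (@pseries_eq0 _ (Num.min r e)); first by rewrite lt_min r0.
  move=> k k0; rewrite !lt_min -andbA => /and3P[k1 k2 k3].
  have -> : 0 = F (x + k) - G (x + k) by rewrite FG// subrr.
  by apply: cvg_pseriesB; [apply: uF|apply: vG]; rewrite gtr0_norm.
apply: (cvg_unique _ (uF _ h1)) => //.
by rewrite (_ : u = v); [exact: vG|exact/funext].
Qed.

(** A connectedness argument: agreement holds to the right of the infimum [y0] of the points down to
    which [F] and [G] agree, and analyticity pushes it to the left of [y0] unless [z] has been
    reached. *)
Lemma gauss_continuation_unique (a b c : R) (F G : R -> R) :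
  gauss_continuation a b c F -> gauss_continuation a b c G ->
  forall z, z <= 0 -> F z = G z.
Proof.
move=> [F1 aF] [G1 aG] z z0.
have FG1 x : `|x| < 1 -> F x = G x.
  by move=> x1; apply: (cvg_unique _ (F1 _ x1)) => //; exact: G1.
pose E : set R := [set y | z <= y <= 0 /\ forall x, y <= x <= 0 -> F x = G x].
have E0 : E 0.
  split; first by rewrite z0 lexx.
  by move=> x; rewrite -eq_le => /eqP <-; apply: FG1; rewrite normr0.
have Elb : lbound E z by move=> y [/andP[]].
have Einf : has_inf E by split; [exists 0|exists z].
pose y0 := inf E.
have y0z : z <= y0 by apply: lb_le_inf => //; exists 0.
have y00 : y0 <= 0 by apply: ge_inf => //; exists z.
have y0FG x : y0 < x -> x <= 0 -> F x = G x.
  move=> y0x x0; have d0 : 0 < x - y0 by rewrite subr_gt0.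
  have [y [_ Ey]] := inf_adherent d0 Einf.
  rewrite -/y0 addrC subrK => yx; apply: Ey; by rewrite (ltW yx).
have [r r0 rFG] : exists2 r, 0 < r &
    forall h, `|h| < r -> F (y0 + h) = G (y0 + h).
  (* The range 1 for [h] keeps any point [y0 + h > 0] inside the unit disc, where both functions are
     the sum of the Gauss series. *)
  apply: (@analytic_identity _ _ _ 1) => //; [apply: aF; lra|apply: aG; lra|].
  move=> h h0 h1; have [yh|yh] := leP (y0 + h) 0; first by apply: y0FG => //; lra.
  by apply: FG1; rewrite gtr0_norm//; lra.
(* A point left of [y0] by half the radius, but not past [z]. It lies in [E], so minimality of [y0]
   forces [y1 = z]. *)
pose y1 := Num.max z (y0 - r / 2).
have zy1 : z <= y1 by rewrite le_max lexx.
have ry1 : y0 - r / 2 <= y1 by rewrite le_max lexx orbT.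
have Ey1 : E y1.
  split; first by rewrite zy1 ge_max z0/=; lra.
  move=> x /andP[y1x x0]; have [xy0|xy0] := leP x y0; last exact: y0FG.
  rewrite -(subrK y0 x) addrC; apply: rFG; rewrite ltr_norml; lra.
have : y0 <= y1 by apply: ge_inf => //; exists z.
rewrite /y1 le_max => /orP[y0z'|]; last lra.
have yz : y1 = z by rewrite /y1 max_l//; lra.
by move: Ey1; rewrite yz => -[_]; apply; rewrite lexx.
Qed.

(** [hyp2F1] is a chosen continuation; exhibiting one continuation shows that the choice is genuine,
    and uniqueness identifies it. *)
Lemma hyp2F1_eq (a b c : R) (F : R -> R) : gauss_continuation a b c F ->
  forall z, z <= 0 -> hyp2F1 a b c z = F z.
Proof.
move=> cF; apply: gauss_continuation_unique (cF).
by apply: (@xgetPex _ (fun=> 0) [set F | gauss_continuation a b c F]); exists F.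
Qed.

End PowerSeries.

(** * An integral representation of 2F1 *)

Section NegativeBinomial.
Context {R : realType}.
Implicit Types (y rho : R) (m n : nat).

(** The coefficient of [y ^+ n] in the expansion of [(1 - y)^-1 ^+ m.+1]. *)
Definition negbin m n : R := 'C(n + m, m)%:R.

(** Pascal's rule, summed: multiplication by [1 - y] lowers the order by one, with an explicit
    remainder for the partial sums. *)
Lemma negbin_recr m n y : (1 - y) * pseries (negbin m.+1) y n =
  pseries (negbin m) y n - 'C(n + m, m.+1)%:R * y ^+ n.
Proof.
rewrite /pseries/= /series/=; elim: n => [|n IH].
  by rewrite !big_nil add0n bin_small// mul0r subr0 mulr0.
rewrite !big_nat_recr//= mulrDr IH /negbin addSn addnS binS natrD exprS.
ring.
Qed.

Lemma pseries_negbin_nd m rho : 0 <= rho ->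
  nondecreasing_seq (pseries (negbin m) rho).
Proof.
move=> r0; apply: nondecreasing_series => i _ _.
by rewrite mulr_ge0 ?exprn_ge0// ler0n.
Qed.

Lemma norm_pseries_negbin_le m y rho n : `|y| <= rho ->
  `|pseries (negbin m) y n| <= pseries (negbin m) rho n.
Proof.
move=> yr; rewrite /pseries/= /series/=; apply: (le_trans (ler_norm_sum _ _ _)).
apply: ler_sum => i _; rewrite normrM ger0_norm ?ler0n// ler_wpM2l ?ler0n//.
by rewrite normrX lerXn2r// nnegrE// (le_trans _ yr).
Qed.

(** Induction on [m]. At the absolute value of [y], [negbin_recr] bounds the increasing partial
    sums, which gives absolute convergence; the same recurrence then identifies the limit. *)
Lemma cvg_pseries_negbin m y : `|y| < 1 ->
  pseries (negbin m) y @ \oo --> (1 - y)^-1 ^+ m.+1.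
Proof.
elim: m y => [|m IH] y y1.
  rewrite expr1 -[X in _ --> X]mul1r.
  rewrite (_ : pseries _ _ = series (geometric 1 y)).
    exact: cvg_geometric_series.
  by apply/funext => n; apply: eq_bigr => i _ /=; rewrite /negbin bin0.
have y1' : 1 - y != 0 by rewrite subr_eq0 eq_sym lt_eqF// ltr_normlW.
have cP : cvgn (pseries (negbin m.+1) `|y|).
  apply: nondecreasing_is_cvgn; first exact: pseries_negbin_nd.
  have cm := IH `|y|; rewrite normr_id in cm; have {}cm := cm y1.
  exists ((1 - `|y|)^-1 * limn (pseries (negbin m) `|y|)) => _ [n _ <-].
  rewrite ler_pdivlMl ?subr_gt0// negbin_recr.
  apply: (@le_trans _ _ (pseries (negbin m) `|y| n)).
    by rewrite gerBl mulr_ge0 ?exprn_ge0// ler0n.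
  apply: nondecreasing_cvgn_le; first exact: pseries_negbin_nd.
  by apply/cvg_ex; eexists; exact: cm.
have {}cP : cvgn (pseries (negbin m.+1) y).
  apply: normed_cvg; rewrite /normed_series_of/=.
  rewrite (_ : (fun _ => _) = (fun i => negbin m.+1 i * `|y| ^+ i))//.
  by apply/funext => i; rewrite normrM normrX ger0_norm// ler0n.
suff: (fun n => pseries (negbin m.+1) y n.+1) @ \oo --> (1 - y)^-1 ^+ m.+2.
  by rewrite (cvg_shiftS (pseries (negbin m.+1) y)).
(* At index [n.+1] the remainder is [y] times the [n]-th term of the series just shown to converge,
   so it tends to 0. *)
have -> : (fun n => pseries (negbin m.+1) y n.+1) =
    (fun n => (pseries (negbin m) y n.+1 - negbin m.+1 n * y ^+ n * y) / (1 - y)).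
  apply/funext => n; rewrite -mulrA -exprSr /negbin addnS -addSn -negbin_recr.
  by rewrite [X in X / _]mulrC mulfK.
have -> : (1 - y)^-1 ^+ m.+2 = ((1 - y)^-1 ^+ m.+1 - 0 * y) / (1 - y).
  by rewrite mul0r subr0 exprSr.
apply: cvgMr_tmp; apply: cvgB.
  by rewrite (cvg_shiftS (pseries (negbin m) y)); exact: IH.
by apply: cvgMr_tmp; exact: cvg_series_cvg_0 cP.
Qed.

Lemma pseries_negbin_bounded m y rho n : `|y| <= rho -> rho < 1 ->
  `|pseries (negbin m) y n| <= (1 - rho)^-1 ^+ m.+1.
Proof.
move=> yr r1; apply: (le_trans (norm_pseries_negbin_le m n yr)).
have r0 : 0 <= rho by exact: le_trans yr.
have := @cvg_pseries_negbin m rho; rewrite ger0_norm// => /(_ r1) c.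
rewrite -(cvg_lim _ c)//; apply: nondecreasing_cvgn_le.
  exact: pseries_negbin_nd.
by apply/cvg_ex; eexists; exact: c.
Qed.

End NegativeBinomial.

(** * Taylor expansion of integrals of powers of 1 / (1 - z X) over the unit interval *)

Section KernelIntegral.
Context {R : realType} (X : R -> R).
Local Notation mu := (@lebesgue_measure R).
Local Notation D := (`[0, 1]%classic : set R).
Hypothesis mX : measurable_fun D X.
Hypothesis X01 : forall v, D v -> 0 <= X v <= 1.
Implicit Types (z h : R) (M n : nat).

Definition kernel_integral M z : R := \int[mu]_(v in D) (1 - z * X v)^-1 ^+ M.+1.

(** The [n]-th Taylor coefficient of [kernel_integral M] at [z], obtained by expanding the
    integrand. *)
Definition kernel_coef M z n : R :=
  \int[mu]_(v in D) (negbin M n * (X v ^+ n * (1 - z * X v)^-1 ^+ (n + M.+1))).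

(** On nonnegative reals the inverse is the real power with exponent -1, which is measurable. *)
Lemma measurable_fun_invr_ge0 (E : set R) (f : R -> R) : measurable_fun E f ->
  (forall v, E v -> 0 <= f v) -> measurable_fun E (fun v => (f v)^-1).
Proof.
move=> mf f0; apply: (@eq_measurable_fun _ _ _ _ E (fun v => f v `^ (-1))).
  by move=> v /set_mem Ev; rewrite powR_inv1// f0.
by apply: (@measurableT_comp _ _ _ _ _ _ (fun x : R => x `^ (-1)) E f).
Qed.

Lemma unit_itv_integrable (f : R -> R) (K : R) : measurable_fun D f ->
  (forall v, D v -> `|f v| <= K) -> mu.-integrable D (EFin \o f).
Proof.
move=> mf fK; apply: measurable_bounded_integrable => //.
  by rewrite /= lebesgue_measure_itv/= lte01 oppr0 adde0 ltry.
exists K; split; first exact: num_real.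
by move=> x Kx v Dv /=; rewrite (le_trans (fK _ Dv))// ltW.
Qed.

Lemma kernel_base_gt0 z v : z < 1 -> D v -> 0 < 1 - z * X v.
Proof.
move=> z1 Dv; have /andP[x0 x1] := X01 Dv.
have [z0|z0] := leP z 0.
  by have := mulr_le0_ge0 z0 x0; lra.
by rewrite subr_gt0 (le_lt_trans _ z1)// ler_piMr// ltW.
Qed.

(** [1 - z * x] is affine in [x], so on the unit interval it is at least the smaller of its endpoint
    values 1 and [1 - z]. *)
Lemma kernel_base_inv_le z v : z < 1 -> D v ->
  (1 - z * X v)^-1 <= (Num.min 1 (1 - z))^-1.
Proof.
move=> z1 Dv; have /andP[x0 x1] := X01 Dv.
have m0 : 0 < Num.min 1 (1 - z) by rewrite lt_min subr_gt0 z1 ltr01.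
rewrite lef_pV2 ?posrE ?kernel_base_gt0//.
rewrite ge_min; have [z0|z0] := leP z 0.
  by apply/orP; left; have := mulr_le0_ge0 z0 x0; lra.
by apply/orP; right; rewrite lerD2l lerN2 ler_piMr// ltW.
Qed.

Lemma measurable_kernel_base_inv z : z < 1 ->
  measurable_fun D (fun v => (1 - z * X v)^-1).
Proof.
move=> z1; apply: measurable_fun_invr_ge0.
  by apply: measurable_funB => //; exact: measurable_funM.
by move=> v Dv; rewrite ltW// kernel_base_gt0.
Qed.

Lemma kernel_coef_integrable M z n : z < 1 -> mu.-integrable D (EFin \o
  (fun v => negbin M n * (X v ^+ n * (1 - z * X v)^-1 ^+ (n + M.+1)))).
Proof.
move=> z1; apply: (@unit_itv_integrable _
  (negbin M n * (1 * (Num.min 1 (1 - z))^-1 ^+ (n + M.+1)))).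
  apply: measurable_funM => //; apply: measurable_funM.
    exact: measurable_funX.
  by apply: measurable_funX; exact: measurable_kernel_base_inv.
move=> v Dv; have /andP[x0 x1] := X01 Dv; have b0 := kernel_base_gt0 z1 Dv.
have c0 : (0 : R) <= negbin M n by exact: ler0n.
have b1 : 0 <= (1 - z * X v)^-1 by rewrite invr_ge0 ltW.
rewrite ger0_norm; last by rewrite !mulr_ge0 ?exprn_ge0.
rewrite ler_wpM2l// ler_pM ?exprn_ge0//.
  by rewrite exprn_ile1.
by rewrite lerXn2r ?nnegrE ?kernel_base_inv_le// (le_trans b1)//
  kernel_base_inv_le.
Qed.

(** Finite sums commute with the integral. Integrability is carried along because additivity of the
    integral uses it at each step. *)
Lemma pseries_kernel_coefE M z h n : z < 1 ->
  pseries (kernel_coef M z) h n = \int[mu]_(v in D)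
    (pseries (negbin M) (h * X v * (1 - z * X v)^-1) n *
     (1 - z * X v)^-1 ^+ M.+1) /\
  mu.-integrable D (EFin \o (fun v =>
    (pseries (negbin M) (h * X v * (1 - z * X v)^-1) n *
     (1 - z * X v)^-1 ^+ M.+1))).
Proof.
move=> z1; elim: n => [|n [IH1 IH2]].
  split.
    transitivity (0 : R); first by rewrite /pseries/= /series/= big_geq.
    transitivity (\int[mu]_(v in D) (0 : R)); first by rewrite Rintegral_cst// mul0r.
    by apply: eq_Rintegral => v _; rewrite /pseries/= /series/= big_geq// mul0r.
  rewrite (_ : _ \o _ = cst 0%E); first exact: integrable0.
  by apply/funext => v; rewrite /pseries/= /series/= big_geq// mul0r.
pose g v := negbin M n * (X v ^+ n * (1 - z * X v)^-1 ^+ (n + M.+1)).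
have ig : mu.-integrable D (EFin \o (fun v => g v * h ^+ n)).
  rewrite (_ : _ \o _ = (fun v => (g v)%:E * (h ^+ n)%:E)%E); last first.
    by apply/funext => v /=; rewrite EFinM.
  by apply: integrableZr => //; exact: kernel_coef_integrable.
have E : (fun v => pseries (negbin M) (h * X v * (1 - z * X v)^-1) n.+1 *
       (1 - z * X v)^-1 ^+ M.+1) =
    (fun v => pseries (negbin M) (h * X v * (1 - z * X v)^-1) n *
       (1 - z * X v)^-1 ^+ M.+1 + g v * h ^+ n).
  apply/funext => v; rewrite /g /pseries/= /series/= big_nat_recr//= mulrDl.
  congr (_ + _); rewrite !exprMn exprD; ring.
rewrite E; split.
  rewrite RintegralD// -IH1 RintegralZr//; last exact: kernel_coef_integrable.
  by rewrite /pseries/= /series/= big_nat_recr.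
exact: (integrableD _ IH2 ig).
Qed.

(* Pointwise, [1 - (z + h) X = (1 - z X) (1 - y)] with
   [y = h X / (1 - z X)] and [|y| <= |h| / (1 - z) < 1]. *)
Lemma cvg_pseries_kernel M z h : z < 1 -> `|h| < 1 - z ->
  pseries (kernel_coef M z) h @ \oo --> kernel_integral M (z + h).
Proof.
move=> z1 hz; have z1' : 0 < 1 - z by rewrite subr_gt0.
pose y v := h * X v * (1 - z * X v)^-1.
pose rho := `|h| / (1 - z).
have r1 : rho < 1 by rewrite ltr_pdivrMr// mul1r.
have yr v : D v -> `|y v| <= rho.
  move=> Dv; have /andP[x0 x1] := X01 Dv; have b0 := kernel_base_gt0 z1 Dv.
  rewrite /y /rho -mulrA normrM ler_wpM2l// ger0_norm; last first.
    by rewrite divr_ge0// ltW.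
  (* The bound amounts to [X v * (1 - z) <= 1 - z * X v], that is [X v <= 1]. *)
  by rewrite ler_pdivrMr// mulrC ler_pdivlMr//; lra.
pose f n v := pseries (negbin M) (y v) n * (1 - z * X v)^-1 ^+ M.+1.
pose g v := (1 - (z + h) * X v)^-1 ^+ M.+1.
pose K := (1 - rho)^-1 ^+ M.+1 * (Num.min 1 (1 - z))^-1 ^+ M.+1.
have zh1 : z + h < 1 by have := ltr_normlW hz; lra.
have mf n : measurable_fun D (EFin \o f n).
  by have [_ /measurable_int] := pseries_kernel_coefE M h n z1.
have mg : measurable_fun D (EFin \o g).
  by apply/measurable_EFinP/measurable_funX; exact: measurable_kernel_base_inv.
have fg v : D v -> f ^~ v @ \oo --> g v.
  move=> Dv; have b0 := kernel_base_gt0 z1 Dv.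
  have -> : g v = (1 - y v)^-1 ^+ M.+1 * (1 - z * X v)^-1 ^+ M.+1.
    rewrite -exprMn -invfM /g; congr (_^-1 ^+ _).
    by rewrite /y; field; rewrite gt_eqF.
  apply: cvgMr_tmp; apply: cvg_pseries_negbin.
  exact: le_lt_trans (yr v Dv) r1.
have fK n v : D v -> `|f n v| <= K.
  move=> Dv; have b0 := kernel_base_gt0 z1 Dv.
  have b1 : 0 <= (1 - z * X v)^-1 by rewrite invr_ge0 ltW.
  rewrite normrM ler_pM//.
    exact: pseries_negbin_bounded (yr v Dv) r1.
  rewrite ger0_norm ?exprn_ge0// lerXn2r ?nnegrE ?kernel_base_inv_le//.
  by rewrite (le_trans b1)// kernel_base_inv_le.
have iK : mu.-integrable D (EFin \o cst K).
  apply: (@unit_itv_integrable _ `|K|) => //; exact: measurable_cst.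
have [] := @dominated_convergence _ _ _ mu D _ (fun n => EFin \o f n)
  (EFin \o g) (EFin \o cst K) mf mg _ iK _ => //.
- by apply: aeW => v Dv; apply: cvg_EFin; [exact: nearW|exact: fg].
- by apply: aeW => v n Dv; rewrite /= lee_fin; exact: fK.
move=> ig _ cI.
have -> : pseries (kernel_coef M z) h =
    (fun n => fine (\int[mu]_(v in D) (EFin \o f n) v)).
  by apply/funext => n; have [-> _] := pseries_kernel_coefE M h n z1.
apply: fine_cvg; rewrite /kernel_integral /Rintegral fineK//.
exact: integrable_fin_num.
Qed.

End KernelIntegral.

(** * Real powers on the unit interval *)

Lemma powR_cvg_at0 {R : realType} (a : R) : 0 < a ->
  x `^ a @[x --> 0^'+] --> (0 : R) `^ a.
Proof. by move=> a0; rewrite powR0 ?gt_eqF//; exact: powR_cvg0. Qed.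

Lemma powR_itv01 {R : realType} (a v : R) : 0 <= a -> 0 <= v <= 1 ->
  0 <= v `^ a <= 1.
Proof.
move=> a0 /andP[v0 v1]; rewrite powR_ge0/=.
rewrite [leRHS](_ : _ = 1 `^ a); last by rewrite powR1.
by rewrite ge0_ler_powR// nnegrE.
Qed.

Lemma powR_continuous {R : realType} (a x : R) : 0 < x ->
  {for x, continuous (fun y : R => y `^ a)}.
Proof.
move=> x0; apply: differentiable_continuous; apply/derivable1_diffP.
by apply: derivable_powR; rewrite in_itv/= x0.
Qed.

Lemma Rintegral_powR01 {R : realType} (a : R) : 0 <= a ->
  \int[lebesgue_measure]_(v in `[0, 1]%classic) v `^ a = (a + 1)^-1.
Proof.
move=> a0; have a1 : 0 < a + 1 by rewrite ltr_wpDl.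
rewrite /Rintegral (@continuous_FTC2 _ _ (fun v => v `^ (a + 1) / (a + 1)))//.
- by rewrite powR0 ?gt_eqF// powR1 mul0r mul1r sube0.
(* The exponent 0 is treated apart: the integrand is then constantly 1, also at 0, whereas positive
   powers tend to 0 there. *)
- move: a0; rewrite le_eqVlt => /predU1P[<-|a0].
    rewrite (_ : (fun v : R => v `^ 0) = cst 1); last by apply/funext => v; rewrite powRr0.
    by apply: continuous_subspaceT => v; exact: cst_continuous.
  apply/continuous_within_itvP => //; split.
  + by move=> v; rewrite in_itv/= => /andP[v0 _]; exact: powR_continuous.
  + exact: powR_cvg_at0.
  + by apply: cvg_at_left_filter; exact: powR_continuous.
- split.
  + move=> v; rewrite in_itv/= => /andP[v0 _]; apply: derivableM => //.
    by apply: derivable_powR; rewrite in_itv/= v0.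
  + by apply: cvgMr_tmp; exact: powR_cvg_at0.
  + by apply: cvgMr_tmp; apply: cvg_at_left_filter; exact: powR_continuous.
- move=> v; rewrite in_itv/= => /andP[v0 _].
  have v0' : v \in `]0, +oo[%R by rewrite in_itv/= v0.
  rewrite derive1Mr; last exact: derivable_powR.
  by rewrite powR_derive1// addrK mulrAC divff ?mul1r// gt_eqF.
Qed.

(** * Euler's integral as the continuation of the Gauss series *)

Section EulerRepresentation.
Context {R : realType} (theta : R).
Hypothesis theta01 : 0 < theta < 1.
Local Notation mu := (@lebesgue_measure R).
Local Notation D := (`[0, 1]%classic : set R).

Let beta := (1 - theta)^-1.

Let beta_gt0 : 0 < beta.
Proof. by rewrite /beta invr_gt0 subr_gt0; case/andP: theta01. Qed.

Let X (v : R) := v `^ beta.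

Let mX : measurable_fun D X.
Proof. by apply: measurable_funTS; exact: measurable_powR. Qed.

Let X01 v : D v -> 0 <= X v <= 1.
Proof.
by rewrite /= in_itv/= => v01; exact: powR_itv01 (ltW _) v01.
Qed.

(* Euler's integral for 2F1[-theta, m+1; 1-theta; z], integrated by parts and
   with the singular weight removed by the substitution x = v^beta, under which
   x^(-theta) dx = beta dv. *)
Definition euler_hyp2F1 (m : nat) (z : R) : R :=
  (1 - z)^-1 ^+ m.+1 - m.+1%:R * beta * (z * kernel_integral X m.+1 z).

(** Taylor coefficients of [euler_hyp2F1 m] at [z]. The shifted term comes from the [h] in the
    factor [z + h] of the kernel integral. *)
Definition euler_coef (m : nat) (z : R) (n : nat) : R :=
  negbin m n * (1 - z)^-1 ^+ (n + m.+1) - m.+1%:R * beta *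
  (z * kernel_coef X m.+1 z n +
   if n is k.+1 then kernel_coef X m.+1 z k else 0).

Lemma cvg_pseries_euler m z h : z < 1 -> `|h| < 1 - z ->
  pseries (euler_coef m z) h @ \oo --> euler_hyp2F1 m (z + h).
Proof.
move=> z1 hz; have z1' : 0 < 1 - z by rewrite subr_gt0.
pose w := kernel_coef X m.+1 z.
have cw : pseries w h @ \oo --> kernel_integral X m.+1 (z + h).
  exact: cvg_pseries_kernel.
pose w' n := if n is k.+1 then w k else 0.
have cw' : pseries w' h @ \oo --> h * kernel_integral X m.+1 (z + h).
  suff: (fun n => pseries w' h n.+1) @ \oo --> h * kernel_integral X m.+1 (z + h).
    by rewrite (cvg_shiftS (pseries w' h)).
  have -> : (fun n => pseries w' h n.+1) = (fun n => h * pseries w h n).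
    by apply/funext => n; rewrite pseriesS add0r.
  exact: cvgMl_tmp.
have cn : (fun n => pseries (negbin m) (h / (1 - z)) n * (1 - z)^-1 ^+ m.+1)
    @ \oo --> (1 - (z + h))^-1 ^+ m.+1.
  have -> : (1 - (z + h))^-1 ^+ m.+1 =
      (1 - h / (1 - z))^-1 ^+ m.+1 * (1 - z)^-1 ^+ m.+1.
    rewrite -exprMn -invfM; congr (_^-1 ^+ _).
    by field; rewrite gt_eqF.
  apply: cvgMr_tmp; apply: cvg_pseries_negbin.
  by rewrite normrM normfV (gtr0_norm z1') ltr_pdivrMr// mul1r.
have -> : pseries (euler_coef m z) h = (fun n =>
    pseries (negbin m) (h / (1 - z)) n * (1 - z)^-1 ^+ m.+1 -
    m.+1%:R * beta * (z * pseries w h n + pseries w' h n)).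
  apply/funext => n; rewrite /pseries/= /series/= mulr_suml mulr_sumr -big_split/=.
  rewrite mulr_sumr -sumrB; apply: eq_bigr => i _.
  rewrite /euler_coef -/w -/(w' i) exprMn exprD; ring.
rewrite /euler_hyp2F1 (mulrDl z h); apply: cvgB; first exact: cn.
by apply: cvgMl_tmp; apply: cvgD; [exact: cvgMl_tmp|].
Qed.

Lemma rising_succ m n : rising (m.+1%:R : R) n * m`!%:R = (n + m)`!%:R.
Proof.
elim: n => [|n IH]; first by rewrite /rising big_ord0 mul1r.
rewrite /rising big_ord_recr/= -/(rising _ n) mulrAC IH addSn factS mulnC natrM.
by congr (_ * _); rewrite -natrD addSn addnC.
Qed.

(** The two products share all factors but the first of the numerator and the last of the
    denominator. *)
Lemma rising_ratio n :
  rising (- theta) n / rising (1 - theta) n = - theta / (n%:R - theta).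
Proof.
have /andP[t0 t1] := theta01.
have nz i : (i.+1%:R : R) - theta != 0.
  have : (1 : R) <= i.+1%:R by rewrite ler1n.
  by move=> i1; rewrite gt_eqF//; lra.
elim: n => [|n IH].
  by rewrite /rising !big_ord0 sub0r !divff// oppr_eq0 gt_eqF//; lra.
rewrite /rising !big_ord_recr/= -/(rising _ n) -/(rising (1 - theta) n).
rewrite invfM mulrACA IH (_ : - theta + n%:R = n%:R - theta); last ring.
rewrite (_ : 1 - theta + n%:R = n.+1%:R - theta); last by rewrite -natr1; ring.
rewrite mulrA divfK//; case: n {IH} => [|n]; last exact: nz.
by rewrite sub0r oppr_eq0 gt_eqF//; lra.
Qed.

Lemma kernel_coef_powR0 M n :
  kernel_coef X M 0 n = negbin M n / (beta * n%:R + 1).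
Proof.
rewrite -Rintegral_powR01; last by rewrite mulr_ge0// ltW.
rewrite -RintegralZl//.
  apply: eq_Rintegral => v _.
  by rewrite mul0r subr0 invr1 expr1n mulr1 /X powRrM powR_mulrn// powR_ge0.
apply: (@unit_itv_integrable _ _ 1); first by apply: measurable_funTS; exact: measurable_powR.
move=> v; rewrite /= in_itv/= => v01.
by have /andP[p0 p1] := powR_itv01 (mulr_ge0 (ltW beta_gt0) (ler0n R n)) v01;
  rewrite ger0_norm.
Qed.

(** The Gauss coefficient is [negbin m n] times [- theta / (n - theta) = 1 - n / (n - theta)]. The 1
    is the boundary term, and the kernel integral supplies the other part. *)
Lemma euler_coef0 m n :
  euler_coef m 0 n = gauss_coef (- theta) m.+1%:R (1 - theta) n.
Proof.
have /andP[t0 t1] := theta01.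
have nz i : (i.+1%:R : R) - theta != 0.
  have : (1 : R) <= i.+1%:R by rewrite ler1n.
  by move=> i1; rewrite gt_eqF//; lra.
have fn k : (k`!%:R : R) != 0 by rewrite pnatr_eq0 -lt0n fact_gt0.
have cE : rising (m.+1%:R : R) n / n`!%:R = negbin m n.
  apply: (mulIf (fn m)); rewrite mulrAC rising_succ.
  apply: (mulIf (fn n)); rewrite divfK// /negbin -!natrM; congr (_%:R).
  by rewrite -(bin_fact (leq_addl n m)) addnK mulnA.
have -> : gauss_coef (- theta) m.+1%:R (1 - theta) n =
    rising (- theta) n / rising (1 - theta) n * (rising m.+1%:R n / n`!%:R).
  by rewrite /gauss_coef; ring.
rewrite rising_ratio cE.
rewrite /euler_coef subr0 invr1 expr1n mulr1 mul0r add0r.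
case: n cE => [|n] cE.
  by rewrite mulr0 subr0 sub0r divff ?mul1r// oppr_eq0 gt_eqF//; lra.
rewrite kernel_coef_powR0.
have mE : m.+1%:R * negbin m.+1 n = n.+1%:R * negbin m n.+1 :> R.
  rewrite /negbin -!natrM addSnnS; congr (_%:R).
  by rewrite mul_bin_left addnS -addSn addnK.
have bE : beta / (beta * n%:R + 1) = (n.+1%:R - theta)^-1.
  have := nz n; rewrite -natr1 /beta => nz'.
  by field; rewrite nz' gt_eqF//; lra.
rewrite (_ : m.+1%:R * beta * _ =
    m.+1%:R * negbin m.+1 n * (beta / (beta * n%:R + 1))); last by ring.
rewrite mE bE.
by move: (n.+1%:R) (negbin m n.+1) (nz n) => N b nz'; field.
Qed.

Lemma euler_gauss_continuation m :
  gauss_continuation (- theta) m.+1%:R (1 - theta) (euler_hyp2F1 m).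
Proof.
split=> [z z1|z z1].
  rewrite (_ : gauss_coef _ _ _ = euler_coef m 0).
    by rewrite -[X in _ --> euler_hyp2F1 m X]add0r; apply: cvg_pseries_euler;
      rewrite ?subr0.
  by apply/funext => n; rewrite euler_coef0.
exists (euler_coef m z), (1 - z); split; first by rewrite subr_gt0.
by move=> h hz; exact: cvg_pseries_euler.
Qed.

Lemma hyp2F1_euler m z : z <= 0 ->
  hyp2F1 (- theta) m.+1%:R (1 - theta) z = euler_hyp2F1 m z.
Proof. exact/hyp2F1_eq/euler_gauss_continuation. Qed.

(** For [z <= 0] Euler's formula is a positive boundary term plus a nonnegative integral term. *)
Lemma hyp2F1_gt0 m z : z <= 0 ->
  0 < hyp2F1 (- theta) m.+1%:R (1 - theta) z.
Proof.
move=> z0; rewrite hyp2F1_euler// /euler_hyp2F1.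
have J0 : 0 <= kernel_integral X m.+1 z.
  apply: Rintegral_ge0 => v Dv; rewrite exprn_ge0// invr_ge0 ltW//.
  by apply: kernel_base_gt0 => //; exact: le_lt_trans ltr01.
rewrite ltr_wpDr//; last by rewrite exprn_gt0// invr_gt0; lra.
rewrite oppr_ge0 mulr_ge0_le0//; last exact: mulr_le0_ge0.
by rewrite mulr_ge0// ltW.
Qed.

End EulerRepresentation.

(** * The Gamma function *)

Section OpenHalfLine.
Context {R : realType}.
Local Notation mu := (@lebesgue_measure R).
Local Notation D := (`]0, +oo[%classic : set R).

(** The intervals from [lo n] to [hi n] exhaust the open half-line; the one at [n = 0] is the single
    point 1. *)
Let lo n : R := n.+1%:R^-1.
Let hi n : R := n.+1%:R.

Let lo_gt0 n : 0 < lo n. Proof. by rewrite invr_gt0 ltr0n. Qed.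

Let lo_le1 n : lo n <= 1.
Proof. by rewrite invf_le1 ?ler1n// ltr0n. Qed.

Let hi_ge1 n : 1 <= hi n. Proof. by rewrite ler1n. Qed.

Let lo_hi n : lo n <= hi n. Proof. exact: le_trans (lo_le1 n) (hi_ge1 n). Qed.

Let lo_nd m n : (m <= n)%N -> lo n <= lo m.
Proof. by move=> mn; rewrite lef_pV2 ?posrE ?ltr0n// ler_nat. Qed.

Let hi_nd m n : (m <= n)%N -> hi m <= hi n.
Proof. by move=> mn; rewrite ler_nat. Qed.

Let between w : 0 < w -> exists n, lo n <= w <= hi n.
Proof.
move=> w0; have w0' : 0 <= w^-1 by rewrite invr_ge0 ltW.
pose n := maxn (Num.bound w) (Num.bound w^-1).
exists n; apply/andP; split.
  rewrite -[leRHS]invrK lef_pV2 ?posrE ?invr_gt0 ?ltr0n//.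
  apply: (le_trans (ltW (archi_boundP w0'))); rewrite ler_nat.
  by rewrite (leq_trans (leq_maxr (Num.bound w) _)).
apply: (le_trans (ltW (archi_boundP (ltW w0)))); rewrite ler_nat.
by rewrite (leq_trans (leq_maxl _ (Num.bound w^-1))).
Qed.

(** Monotone convergence along the exhaustion. The map [Phi] is a parameter so that both sides of a
    substitution are covered, one of them with the identity. *)
Lemma cvg_integral_open_half_line (Phi : R -> R) (f : R -> \bar R) :
  (forall x y, 0 < x -> x <= y -> Phi x <= Phi y) ->
  (forall x, 0 < x -> 0 < Phi x) ->
  (forall s, 0 < s -> exists2 w, 0 < w & Phi w = s) ->
  measurable_fun D f -> (forall x, D x -> (0 <= f x)%E) ->
  (\int[mu]_(x in `[Phi (lo n), Phi (hi n)]%classic) f x)%E @[n --> \oo] -->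
  (\int[mu]_(x in D) f x)%E.
Proof.
move=> Phi_nd Phi0 Phi_surj mf f0.
pose J n : set R := `[Phi (lo n), Phi (hi n)]%classic.
have JD n : J n `<=` D.
  move=> x; rewrite /J /= !in_itv/= => /andP[h _]; rewrite andbT.
  by apply: lt_le_trans h; exact: Phi0.
have -> : D = \bigcup_n J n.
  apply/seteqP; split => [s|s [n _ /JD//]].
  rewrite /= in_itv/= andbT => /Phi_surj[w w0 <-].
  have [n /andP[h1 h2]] := between w0; exists n => //.
  by rewrite /J /= in_itv/= !Phi_nd.
apply: ge0_nondecreasing_set_cvg_integral.
- move=> m n mn; rewrite subsetEset => x; rewrite /J /= !in_itv/= => /andP[h1 h2].
  rewrite (le_trans _ h1)/= ?(le_trans h2)// Phi_nd ?lo_nd ?hi_nd//.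
- by [].
- by move=> n; apply: measurable_funS mf => //; exact: JD.
- by move=> n x /JD; exact: f0.
Qed.

(** The formula on compact intervals is passed to the limit; the integrands are nonnegative, so
    infinite values are allowed. *)
Lemma integration_by_substitution_open_half_line (Phi G : R -> R) :
  (forall x y, 0 < x -> x < y -> Phi x < Phi y) ->
  (forall x, 0 < x -> 0 < Phi x) ->
  (forall s, 0 < s -> exists2 w, 0 < w & Phi w = s) ->
  (forall x, 0 < x -> derivable Phi x 1) ->
  (forall x, 0 < x -> {for x, continuous Phi^`()%classic}) ->
  (forall x, 0 < x -> 0 <= Phi^`()%classic x) ->
  (forall x, 0 < x -> {for x, continuous G}) ->
  (forall x, 0 < x -> 0 <= G x) ->
  (\int[mu]_(x in D) (G x)%:E = \int[mu]_(x in D) (G (Phi x) * Phi^`()%classic x)%:E)%E.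
Proof.
move=> Phi_incr Phi0 Phi_surj dPhi cdPhi dPhi0 cG G0.
have cPhi x : 0 < x -> {for x, continuous Phi}.
  by move=> x0; apply/differentiable_continuous/derivable1_diffP/dPhi.
have D0 x : D x -> 0 < x by rewrite /= in_itv/= andbT.
have mD (g : R -> R) : (forall x, 0 < x -> {for x, continuous g}) ->
    measurable_fun D g.
  move=> cg; apply: open_continuous_measurable_fun; first exact: interval_open.
  by move=> x /set_mem/D0; exact: cg.
have l1 : (\int[mu]_(x in `[Phi (lo n), Phi (hi n)]%classic) (G x)%:E)%E
    @[n --> \oo] --> (\int[mu]_(x in D) (G x)%:E)%E.
  apply: cvg_integral_open_half_line => //.
  - by move=> x y x0; rewrite le_eqVlt => /predU1P[->//|/(Phi_incr _ _ x0)/ltW].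
  - by apply/measurable_EFinP; exact: mD.
  - by move=> x /D0 x0; rewrite lee_fin G0.
have l2 : (\int[mu]_(x in `[lo n, hi n]%classic) (G (Phi x) * Phi^`()%classic x)%:E)%E
    @[n --> \oo] --> (\int[mu]_(x in D) (G (Phi x) * Phi^`()%classic x)%:E)%E.
  apply: (@cvg_integral_open_half_line id) => //.
  - by move=> s s0; exists s.
  - apply/measurable_EFinP; apply: mD => x x0; apply: continuousM; last exact: cdPhi.
    by apply: continuous_comp; [exact: cPhi|apply: cG; exact: Phi0].
  - by move=> x /D0 x0; rewrite lee_fin mulr_ge0 ?dPhi0// G0// Phi0.
apply: (cvg_unique _ l1); first exact: ereal_hausdorff.
apply: cvg_trans l2; apply: near_eq_cvg; apply: nearW => n.
have lP x : lo n <= x -> 0 < x by exact: lt_le_trans.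
have hi0 : 0 < hi n by exact: lt_le_trans (hi_ge1 n).
(* In the degenerate case both integrals are over one point. *)
have := lo_hi n; rewrite le_eqVlt => /predU1P[<-|lh].
  by rewrite !set_itv1 !integral_set1.
rewrite (@integration_by_substitution_increasing _ Phi G) ?lo_hi//.
- by move=> x y; rewrite !in_itv/= => /andP[/lP x0 _] _; exact: Phi_incr.
- by move=> x; rewrite in_itv/= => /andP[/ltW/lP x0 _]; exact: cdPhi.
- by apply/cvg_ex; eexists; apply: cvg_at_right_filter; exact: cdPhi.
- by apply/cvg_ex; eexists; apply: cvg_at_left_filter; exact: cdPhi.
- split.
  + by move=> x; rewrite in_itv/= => /andP[/ltW/lP x0 _]; exact: dPhi.
  + by apply: cvg_at_right_filter; exact: cPhi.
  + by apply: cvg_at_left_filter; exact: cPhi.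
- apply: continuous_in_subspaceT => x /set_mem; rewrite /= in_itv/= => /andP[h _].
  by apply: cG; apply: lt_le_trans h; exact: Phi0.
Qed.

End OpenHalfLine.

(** * Exponential integrals on the half-line *)

Section GammaIntegrals.
Context {R : realType}.
Local Notation mu := (@lebesgue_measure R).
Local Notation D := (`]0, +oo[%classic : set R).

Lemma ge0_FTC2_ray (f F : R -> R) (a l : R) :
  (forall x, a <= x -> 0 <= f x) ->
  (forall x, a <= x -> {for x, continuous f}) ->
  (forall x, a <= x -> is_derive x 1 F (f x)) ->
  F x @[x --> +oo] --> l ->
  (\int[mu]_(x in `]a, +oo[%classic) (f x)%:E = (l - F a)%:E)%E.
Proof.
move=> f0 cf dF Fl.
rewrite integral_itv_obnd_cbnd; last first.
  apply/measurable_EFinP; apply: open_continuous_measurable_fun.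
    exact: interval_open.
  by move=> x /set_mem; rewrite /= in_itv/= andbT => /ltW/cf.
rewrite (@ge0_continuous_FTC2y _ f F a l)//.
- apply/continuous_within_itvcyP; split; last first.
    by apply: cvg_at_right_filter; exact: cf.
  by move=> x; rewrite in_itv/= andbT => /ltW/cf.
- by move=> x /ltW/dF[].
- apply: cvg_at_right_filter; apply/differentiable_continuous/derivable1_diffP.
  by have [] := dF _ (lexx a).
- move=> x; rewrite in_itv/= andbT => /ltW/dF dFx.
  by rewrite derive1E; exact: derive_val.
Qed.

(** From [expR (k * x) >= (k * x) ^+ 2 / 2] the product is at most [2 / k ^+ 2] times [x^-1]. *)
Lemma cvg_mul_expRN (k : R) : 0 < k ->
  (x * expR (- (k * x))) @[x --> +oo] --> (0 : R).
Proof.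
move=> k0; apply: (@squeeze_cvgr _ _ _ _ (cst 0) (fun x => (2 / k ^+ 2) * x^-1)).
- near=> x; have x0 : 0 < x by near: x; exact: nbhs_pinfty_gt.
  rewrite mulr_ge0 ?expR_ge0 ?(ltW x0)//= expRN.
  have kx0 : 0 < k * x by rewrite mulr_gt0.
  have := @expR_ge1Dxn R (k * x) 1 (ltW kx0).
  rewrite (_ : 2`!%:R = 2)// => h.
  rewrite ler_pdivrMr ?expR_gt0//.
  apply: (@le_trans _ _ (2 / k ^+ 2 * x^-1 * ((k * x) ^+ 2 / 2))).
    by rewrite le_eqVlt; apply/orP; left; apply/eqP; field; rewrite !gt_eqF.
  rewrite ler_pM2l; last by rewrite !mulr_gt0// invr_gt0// exprn_gt0.
  by apply: le_trans h; rewrite lerDr.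
- exact: cvg_cst.
- rewrite -[X in _ --> X](mulr0 (2 / k ^+ 2)); apply: cvgMl_tmp.
  by apply/gtr0_cvgV0; [near=> x; near: x; exact: nbhs_pinfty_gt|exact: cvg_id].
Unshelve. all: by end_near. Qed.

Lemma cvg_expRNM (k : R) : 0 < k -> expR (- (k * x)) @[x --> +oo] --> (0 : R).
Proof.
move=> k0; apply: (@cvg_comp _ _ _ (fun x => k * x) (fun z => expR (- z)) _ (pinfty_nbhs R)).
  by apply: gt0_cvgMry => //; exact: cvg_id.
exact: cvgr_expR.
Qed.

Lemma continuous_expRNM (k x : R) : {for x, continuous (fun t => expR (- (k * t)))}.
Proof.
apply: continuous_comp; last exact: continuous_expR.
by apply: continuousN; apply: continuousM; [exact: cvg_cst|exact: cvg_id].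
Qed.

Lemma is_derive_expRNM (k x : R) :
  is_derive x 1 (fun t => expR (- (k * t))) (- k * expR (- (k * x))).
Proof.
have dg : is_derive x 1 (fun t : R => - (k * t)) (- k).
  apply: (@is_derive_eq _ _ _ _ _ _ _ _ (is_deriveN (is_deriveZ k (is_derive_id x 1)))).
  by congr (- _); exact: mulr1.
apply: (@is_derive_eq _ _ _ _ _ _ _ _
  (@is_derive1_comp _ expR (fun t => - (k * t)) x _ _ (is_derive_expR _) dg)).
by rewrite mulrC.
Qed.

Lemma integral_expRN : (\int[mu]_(t in D) (expR (- t))%:E = 1)%E.
Proof.
have E t : expR (- t) = expR (- (1 * t)) :> R by rewrite mul1r.
under eq_integral do rewrite E.
pose F t : R := - expR (- (1 * t)).
transitivity (0 - F 0)%:E; last by rewrite /F mulr0 oppr0 expR0 opprK add0r.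
apply: ge0_FTC2_ray.
- by move=> x _; exact: expR_ge0.
- by move=> x _; exact: continuous_expRNM.
- move=> x _; apply: (@is_derive_eq _ _ _ _ _ _ _ _
    (is_deriveN (is_derive_expRNM 1 x))).
  by rewrite mulN1r opprK.
- by rewrite -oppr0; apply: cvgN; exact: cvg_expRNM.
Qed.

Lemma integral_mul_expRN (k : R) : 0 < k ->
  (\int[mu]_(t in D) (t * expR (- (k * t)))%:E = (k^-1 ^+ 2)%:E)%E.
Proof.
move=> k0; pose e t := expR (- (k * t)).
(* The primitive given by integration by parts; it vanishes at infinity. *)
pose F t := - (k^-1 * (t * e t) + k^-1 ^+ 2 * e t).
transitivity (0 - F 0)%:E; last first.
  by rewrite /F /e mul0r !mulr0 oppr0 expR0 mulr1 add0r opprK add0r.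
apply: ge0_FTC2_ray.
- by move=> x x0; rewrite mulr_ge0// expR_ge0.
- move=> x _; apply: continuousM; first exact: cvg_id.
  exact: continuous_expRNM.
- move=> x _; have de := is_derive_expRNM k x.
  apply: (@is_derive_eq _ _ _ _ _ _ _ _ (is_deriveN (is_deriveD
    (is_deriveZ k^-1 (is_deriveM (is_derive_id x 1) de))
    (is_deriveZ (k^-1 ^+ 2) de)))).
  rewrite /GRing.scale/= /e.
  by move: (expR _) => w; field; rewrite gt_eqF.
- rewrite -[X in _ --> X]oppr0; apply: cvgN.
  rewrite (_ : 0 = k^-1 * 0 + k^-1 ^+ 2 * 0); last by rewrite !mulr0 addr0.
  apply: cvgD; apply: cvgMl_tmp; first exact: cvg_mul_expRN.
  exact: cvg_expRNM.
Qed.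

End GammaIntegrals.

(** * The product Gamma(1 - theta) Gamma(1 + theta) as an integral *)

Section Reflection.
Context {R : realType} (theta : R).
Hypothesis theta01 : 0 < theta < 1.
Local Notation mu := (@lebesgue_measure R).
Local Notation D := (`]0, +oo[%classic : set R).

Let beta := (1 - theta)^-1.

Let beta_gt0 : 0 < beta.
Proof. by rewrite /beta invr_gt0 subr_gt0; case/andP: theta01. Qed.

Let beta_ge1 : 1 <= beta.
Proof.
have /andP[t0 t1] := theta01.
by rewrite /beta invf_ge1 ?gerBl ?subr_gt0// ltW.
Qed.

Let D_gt0 (x : R) : D x -> 0 < x.
Proof. by rewrite /= in_itv/= andbT. Qed.

(** Euler's integral with extended real values, so that Tonelli's theorem applies before finiteness
    is known. *)
Definition egamma (s : R) : \bar R :=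
  (\int[mu]_(t in D) (t `^ (s - 1) * expR (- t))%:E)%E.

Lemma Gamma_egamma s : Gamma s = fine (egamma s).
Proof. by []. Qed.

Lemma egamma_ge0 s : (0 <= egamma s)%E.
Proof.
by apply: integral_ge0 => t _; rewrite lee_fin mulr_ge0 ?powR_ge0 ?expR_ge0.
Qed.

Lemma Gamma1 : Gamma (1 : R) = 1.
Proof.
rewrite Gamma_egamma /egamma.
by under eq_integral do rewrite subrr powRr0 mul1r; rewrite integral_expRN.
Qed.

Lemma is_derive_powRM (c x : R) : 0 < x ->
  is_derive x 1 (fun v => c * v `^ beta) (c * (beta * x `^ (beta - 1))).
Proof. by move=> x0; exact: is_deriveZ (is_derive1_powR beta x0). Qed.

Lemma derive1_powRM (c x : R) : 0 < x ->
  ((fun v : R => c * v `^ beta)^`())%classic x = c * (beta * x `^ (beta - 1)).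
Proof.
by move=> x0; rewrite derive1E; have [_ ->] := is_derive_powRM c x0.
Qed.

(** Under the substitution [t = c * v ^ beta] the singular weight disappears, because
    [beta * theta = beta - 1]. *)
Lemma egamma_scale (c : R) : 0 < c -> egamma (1 - theta) =
  (\int[mu]_(v in D) (c `^ (1 - theta) * beta * expR (- (c * v `^ beta)))%:E)%E.
Proof.
move=> c0; have /andP[t0 t1] := theta01.
have P0 x : 0 < x -> 0 < c * x `^ beta by move=> x0; rewrite mulr_gt0 ?powR_gt0.
rewrite /egamma (@integration_by_substitution_open_half_line _
  (fun v => c * v `^ beta)); last 8 first.
- move=> x y x0 xy; rewrite ltr_pM2l//.
  by apply: gt0_ltr_powR; rewrite // ?in_itv/= ?andbT ?nnegrE ltW// (lt_trans x0).
- exact: P0.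
- move=> s s0; exists ((s / c) `^ (1 - theta)); first by apply: powR_gt0; exact: divr_gt0.
  rewrite -powRrM divff ?subr_eq0 ?gt_eqF// powRr1 ?divr_ge0 ?ltW//.
  by rewrite mulrC divfK ?gt_eqF.
- by move=> x /(is_derive_powRM c)[].
- move=> x x0.
  have h : {for x, continuous (fun v : R => c * (beta * v `^ (beta - 1)))}.
    apply: cvgMl_tmp; apply: cvgMl_tmp; exact: powR_continuous.
  have e : \forall v \near x, c * (beta * v `^ (beta - 1)) =
      ((fun v : R => c * v `^ beta)^`())%classic v.
    near=> v; rewrite derive1_powRM//; near: v; exact: lt_nbhsr.
  rewrite /prop_for /continuous_at derive1_powRM//.
  by apply: cvg_trans h; exact: near_eq_cvg.
- move=> x x0; rewrite derive1_powRM// !mulr_ge0 ?powR_ge0// ltW//.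
- move=> x x0; apply: continuousM; first exact: powR_continuous.
  apply: continuous_comp; last exact: continuous_expR.
  by apply: continuousN; exact: cvg_id.
- by move=> x x0; rewrite mulr_ge0 ?powR_ge0 ?expR_ge0.
apply: eq_integral => v /set_mem/D_gt0 v0; congr EFin.
rewrite derive1_powRM// powRM ?powR_ge0 ?ltW// -powRrM.
have cE : c `^ (1 - theta) = c `^ (1 - theta - 1) * c.
  by rewrite mulrC mulr_powRB1// ?ltW// subr_gt0.
have vE : v `^ (beta * (1 - theta - 1)) * v `^ (beta - 1) = 1.
  rewrite -powRD; last by rewrite (gt_eqF v0) implybT.
  rewrite (_ : _ + _ = 0) ?powRr0// /beta.
  by field; rewrite gt_eqF// subr_gt0.
rewrite cE; transitivity (c `^ (1 - theta - 1) * c * beta *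
  expR (- (c * v `^ beta)) * (v `^ (beta * (1 - theta - 1)) * v `^ (beta - 1))).
  by move: (powR _ _) (expR _) => *; ring.
by rewrite vE mulr1.
Unshelve. all: by end_near. Qed.

(* Tonelli applied to (c t)^(1-theta) beta t^theta e^(-t) e^(-c t v^beta): the
   inner integral over v is egamma (1 - theta), by [egamma_scale] at c t, and
   the one over t is elementary. *)
Lemma egamma_reflection (c : R) : 0 < c ->
  (egamma (1 + theta) * egamma (1 - theta) =
   \int[mu]_(v in D) (c `^ (1 - theta) * beta * (1 + c * v `^ beta)^-1 ^+ 2)%:E)%E.
Proof.
move=> c0; have /andP[t0 t1] := theta01.
pose H t v := c `^ (1 - theta) * beta * (t * expR (- ((1 + c * v `^ beta) * t))).
(* Extension by 0 outside the quadrant, so that Tonelli's theorem is used on the whole plane. *)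
pose f := (fun tv : R * R => (H tv.1 tv.2)%:E) \_ (D `*` D).
have H0 t v : 0 < t -> 0 <= H t v.
  by move=> tp; rewrite !mulr_ge0 ?powR_ge0 ?expR_ge0// ltW.
have mf : measurable_fun setT f.
  apply/(measurable_restrictT _ _).1; first by apply: measurableX.
  apply/measurable_EFinP; apply: measurable_funTS.
  apply: measurable_funM => //; apply: measurable_funM => //.
  apply: measurableT_comp => //; apply: measurableT_comp => //.
  apply: measurable_funM => //; apply: measurable_funD => //.
  apply: measurable_funM => //.
  by apply: (@measurableT_comp _ _ _ _ _ _ (fun x : R => x `^ beta)) => //;
    exact: measurable_powR.
have f0 tv : (0 <= f tv)%E.
  apply: erestrict_ge0 => -[t v] [/= /D_gt0 tp _].
  by rewrite lee_fin H0.
have fE t v : f (t, v) = if (t \in D) && (v \in D) then (H t v)%:E else 0%E.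
  by rewrite /f patchE in_setX.
transitivity (\int[mu]_t \int[mu]_v f (t, v))%E.
  rewrite {1}/egamma -ge0_integralZr//; last 3 first.
  - apply/measurable_EFinP; apply: measurable_funM.
      by apply: measurable_funTS; exact: measurable_powR.
    by apply: measurable_funTS; apply: measurableT_comp => //; exact: measurableT_comp.
  - by move=> t _; rewrite lee_fin mulr_ge0 ?powR_ge0 ?expR_ge0.
  - exact: egamma_ge0.
  rewrite integral_mkcond; apply: eq_integral => t _; rewrite patchE.
  case: ifPn => tD; last first.
    rewrite integral0_eq// => v _; by rewrite fE (negbTE tD).
  have tp := D_gt0 (set_mem tD).
  rewrite (@egamma_scale (c * t)) ?mulr_gt0// -ge0_integralZl//; last 3 first.
  - apply/measurable_EFinP; apply: measurable_funTS.
    apply: measurable_funM => //; apply: measurableT_comp => //.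
    by apply: measurableT_comp => //; exact: measurable_funM.
  - by move=> v _; rewrite lee_fin !mulr_ge0 ?powR_ge0 ?expR_ge0// ltW.
  - by rewrite lee_fin mulr_ge0 ?powR_ge0 ?expR_ge0.
  rewrite integral_mkcond; apply: eq_integral => v _; rewrite patchE fE tD /=.
  case: ifPn => // vD; rewrite -EFinM; congr EFin.
  rewrite /H powRM ?ltW// mulrDl mul1r opprD expRD.
  have tE : t `^ (1 + theta - 1) * t `^ (1 - theta) = t.
    rewrite -powRD; last by rewrite (gt_eqF tp) implybT.
    by rewrite (_ : 1 + theta - 1 + (1 - theta) = 1) ?powRr1// ?ltW//; ring.
  transitivity (c `^ (1 - theta) * beta * (t `^ (1 + theta - 1) *
      t `^ (1 - theta) * (expR (- t) * expR (- (c * t * v `^ beta))))).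
    by move: (expR _) (expR _) => *; ring.
  by rewrite tE [c * t * _]mulrAC.
rewrite (@fubini_tonelli _ _ _ _ _ mu mu f mf f0) [RHS]integral_mkcond.
apply: eq_integral => v _; rewrite patchE; case: ifPn => vD; last first.
  by rewrite integral0_eq// => t _; rewrite fE (negbTE vD) andbF.
have k0 : 0 < 1 + c * v `^ beta.
  by rewrite ltr_wpDr// mulr_ge0 ?powR_ge0// ltW.
rewrite EFinM -(integral_mul_expRN k0) -ge0_integralZl//; last 3 first.
- apply/measurable_EFinP; apply: measurable_funTS.
  apply: measurable_funM => //; apply: measurableT_comp => //.
  by apply: measurableT_comp => //; exact: measurable_funM.
- by move=> t /D_gt0 tp; rewrite lee_fin mulr_ge0 ?expR_ge0// ltW.
- by rewrite lee_fin mulr_ge0 ?powR_ge0// ltW.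
rewrite [RHS]integral_mkcond; apply: eq_integral => t _.
by rewrite patchE fE vD andbT; case: ifPn => // _; rewrite -EFinM.
Qed.

Lemma is_derive_kernel (c x : R) : 0 < c -> 0 < x ->
  is_derive x 1 (fun v => - ((c * beta)^-1 * (1 + c * v `^ beta)^-1))
    (x `^ (beta - 1) * (1 + c * x `^ beta)^-1 ^+ 2).
Proof.
move=> c0 x0.
have k0 : 0 < 1 + c * x `^ beta.
  by rewrite ltr_wpDr// mulr_ge0 ?powR_ge0// ltW.
have d1 : is_derive x 1 (fun v => 1 + c * v `^ beta) (c * (beta * x `^ (beta - 1))).
  apply: (@is_derive_eq _ _ _ _ _ _ _ _
    (is_deriveD (is_derive_cst (1 : R) x 1) (is_derive_powRM c x0))).
  by rewrite add0r.
have d2 := @is_deriveV _ (fun v => 1 + c * v `^ beta) _ _ _ (lt0r_neq0 k0) d1.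
apply: (@is_derive_eq _ _ _ _ _ _ _ _ (is_deriveN (is_deriveZ (c * beta)^-1 d2))).
rewrite /GRing.scale/=.
by field; rewrite !gt_eqF.
Qed.

(** Beyond 1 the factor [v ^ (beta - 1)] is at least 1. Inserting it enlarges the integrand and
    gives it the primitive of [is_derive_kernel]. *)
Lemma kernel_tail (c : R) : 0 < c -> exists T : R,
  [/\ (\int[mu]_(v in `]1%R, +oo[%classic) ((1 + c * v `^ beta)^-1 ^+ 2)%:E = T%:E)%E,
      0 <= T & c * beta * T <= (1 + c)^-1].
Proof.
move=> c0; have cb0 : 0 < c * beta by rewrite mulr_gt0.
have k0 v : 0 < 1 + c * v `^ beta.
  by rewrite ltr_wpDr// mulr_ge0 ?powR_ge0// ltW.
pose E : set R := `]1%R, +oo[%classic.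
pose f v := (1 + c * v `^ beta)^-1 ^+ 2.
pose g v := v `^ (beta - 1) * f v.
have cpow (a v : R) : 1 <= v -> {for v, continuous (fun u : R => u `^ a)}.
  by move=> v1; apply: powR_continuous; exact: lt_le_trans v1.
have cf v : 1 <= v -> {for v, continuous f}.
  move=> v1; apply: continuousM; apply: continuousV; rewrite ?gt_eqF//.
    by apply: cvgD; [exact: cvg_cst|apply: cvgMl_tmp; exact: cpow].
  by apply: cvgD; [exact: cvg_cst|apply: cvgMl_tmp; exact: cpow].
have cg v : 1 <= v -> {for v, continuous g}.
  by move=> v1; apply: continuousM; [exact: cpow|exact: cf].
have mE (h : R -> R) : (forall v, 1 <= v -> {for v, continuous h}) ->
    measurable_fun E (EFin \o h).
  move=> ch; apply/measurable_EFinP; apply: open_continuous_measurable_fun.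
    exact: interval_open.
  by move=> x /set_mem; rewrite /E /= in_itv/= andbT => /ltW/ch.
have f0 v : 0 <= f v by rewrite exprn_ge0// invr_ge0 ltW.
have Ig : (\int[mu]_(v in E) (g v)%:E = ((c * beta)^-1 * (1 + c)^-1)%:E)%E.
  pose F v := - ((c * beta)^-1 * (1 + c * v `^ beta)^-1).
  transitivity (0 - F 1)%:E; last first.
    by rewrite /F powR1 mulr1 sub0r opprK.
  apply: ge0_FTC2_ray => //.
  - by move=> v _; rewrite mulr_ge0 ?powR_ge0.
  - by move=> v v1; apply: is_derive_kernel => //; exact: lt_le_trans v1.
  - rewrite -[X in _ --> X]oppr0; apply: cvgN.
    rewrite -[X in _ --> X](mulr0 (c * beta)^-1); apply: cvgMl_tmp.
    apply: (@squeeze_cvgr _ _ _ _ (cst 0) (fun x => c^-1 * x^-1)).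
    + near=> x; have x1 : 1 <= x by near: x; exact: nbhs_pinfty_ge.
      have x0 : 0 < x by exact: lt_le_trans x1.
      rewrite invr_ge0 (ltW (k0 x))/= -invfM lef_pV2 ?posrE ?mulr_gt0//.
      have : c * x <= c * x `^ beta by rewrite ler_pM2l// le1r_powR.
      lra.
    + exact: cvg_cst.
    + rewrite -[X in _ --> X](mulr0 c^-1); apply: cvgMl_tmp.
      by apply/gtr0_cvgV0; [near=> x; near: x; exact: nbhs_pinfty_gt|exact: cvg_id].
have fg : (\int[mu]_(v in E) (f v)%:E <= \int[mu]_(v in E) (g v)%:E)%E.
  apply: ge0_le_integral => //.
  - by rewrite /E.
  - by move=> v _; rewrite lee_fin.
  - exact: mE.
  - exact: mE.
  - move=> v; rewrite /E /= in_itv/= andbT => /ltW v1; rewrite lee_fin ler_peMl//.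
    by rewrite -[leLHS](powRr0 v) ler_powR// subr_ge0.
have If0 : (0 <= \int[mu]_(v in E) (f v)%:E)%E.
  by apply: integral_ge0 => v _; rewrite lee_fin.
move: fg If0; rewrite Ig; case: (integral _ _ _) => [T| |]//.
rewrite !lee_fin => Tc T0; exists T; split=> //.
by rewrite -ler_pdivlMl.
Unshelve. all: by end_near. Qed.

(** The integral of [egamma_reflection] is split at 1 into the kernel integral at [- c] and the tail
    [T]; multiplying by [c ^ theta] turns the factor [c ^ (1 - theta)] into [c]. *)
Lemma GammaM_reflection (c : R) : 0 < c -> exists T : R,
  [/\ Gamma (1 - theta) * Gamma (1 + theta) * c `^ theta =
        c * beta * (kernel_integral (fun v => v `^ beta) 1 (- c) + T),
      0 < Gamma (1 - theta) * Gamma (1 + theta) * c `^ theta,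
      0 <= T & c * beta * T <= (1 + c)^-1].
Proof.
move=> c0; have /andP[t0 t1] := theta01.
have [T [IT T0 Tc]] := kernel_tail c0; exists T.
pose f v := (1 + c * v `^ beta)^-1 ^+ 2.
set J := kernel_integral _ _ _.
have k0 v : 0 < 1 + c * v `^ beta.
  by rewrite ltr_wpDr// mulr_ge0 ?powR_ge0// ltW.
have f0 v : 0 <= f v by rewrite exprn_ge0// invr_ge0 ltW.
have f1 v : f v <= 1.
  rewrite exprn_ile1// ?invr_ge0 ?(ltW (k0 v))// invf_le1// lerDl.
  by rewrite mulr_ge0 ?powR_ge0// ltW.
have mf (S : set R) : measurable_fun S f.
  apply: measurable_funTS; apply: measurable_funX; apply: measurable_fun_invr_ge0.
    by apply: measurable_funD => //; exact: measurable_funM.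
  by move=> v _; exact: ltW.
have IJ : (\int[mu]_(v in `]0%R, 1%R]%classic) (f v)%:E = J%:E)%E.
  rewrite integral_itv_obnd_cbnd; last by apply/measurable_EFinP.
  have i01 : mu.-integrable `[0, 1]%classic (EFin \o f).
    by apply: (@unit_itv_integrable _ _ 1) => // v _; rewrite ger0_norm.
  rewrite -[LHS]fineK; last exact: integrable_fin_num.
  congr EFin; apply: eq_Rintegral => v _.
  by rewrite /f mulNr opprK.
have ID : (\int[mu]_(v in D) (f v)%:E = (J + T)%:E)%E.
  have -> : D = `]0%R, 1%R]%classic `|` `]1%R, +oo[%classic.
    by rewrite -itv_bndbnd_setU ?bnd_simp.
  rewrite ge0_integral_setU//.
  - by rewrite IJ IT.
  - by apply/measurable_EFinP; exact: mf.
  - by move=> v _; rewrite lee_fin.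
  - apply/disj_set2P; rewrite -subset0 => v [] /=; rewrite !in_itv/= andbT.
    by move=> /andP[_ v1] /(le_lt_trans v1); rewrite ltxx.
have J0 : 0 < J.
  apply: (@lt_le_trans _ _ ((1 + c)^-1 ^+ 2)).
    by rewrite exprn_gt0// invr_gt0 addr_gt0.
  have -> : (1 + c)^-1 ^+ 2 = \int[mu]_(v in `[0, 1]%classic) (1 + c)^-1 ^+ 2.
    rewrite Rintegral_cst//= lebesgue_measure_itv/= lte01 oppr0 adde0/= mulr1.
    by [].
  apply: le_Rintegral => //.
  - by apply: (@unit_itv_integrable _ _ `|(1 + c)^-1 ^+ 2|) => //.
  - apply: (@unit_itv_integrable _ _ 1).
      apply: (eq_measurable_fun f) => // v _; by rewrite /f mulNr opprK.
    by move=> v _; rewrite mulNr opprK ger0_norm ?f1 ?f0.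
  - move=> v; rewrite /= in_itv/= => v01; rewrite mulNr opprK.
    have /andP[_ p1] := powR_itv01 (ltW beta_gt0) v01.
    have k1 : 1 + c * v `^ beta <= 1 + c by rewrite lerD2l ler_piMr// ltW.
    have c1 : 0 < 1 + c by rewrite addr_gt0.
    by rewrite lerXn2r ?nnegrE ?invr_ge0 ?(ltW c1) ?(ltW (k0 v))// lef_pV2 ?posrE.
pose A := c `^ (1 - theta) * beta * (J + T).
have A0 : 0 < A by rewrite !mulr_gt0 ?powR_gt0// ltr_wpDr.
have prod : (egamma (1 + theta) * egamma (1 - theta) = A%:E)%E.
  rewrite (egamma_reflection c0) EFinM -ID -ge0_integralZl//.
  - by apply/measurable_EFinP; exact: mf.
  - by move=> v _; rewrite lee_fin.
  - by rewrite lee_fin mulr_ge0 ?powR_ge0// ltW.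
have -> : Gamma (1 - theta) * Gamma (1 + theta) = A.
  rewrite !Gamma_egamma.
  move: prod (egamma_ge0 (1 + theta)) (egamma_ge0 (1 - theta)).
  (* Both factors are finite: an infinite one would make the product infinite, or 0 by the
     convention for zero times infinity, but the product is the positive real [A]. *)
  case: (egamma (1 + theta)) => [x| |]; case: (egamma (1 - theta)) => [y| |]//.
  - by rewrite -EFinM => -[<-] _ _; rewrite mulrC.
  - move=> P + _; rewrite lee_fin le_eqVlt => /predU1P[x0|x0].
      by move: P A0; rewrite -x0 mul0e => -[<-]; rewrite ltxx.
    by move: P; rewrite gt0_muley ?lte_fin.
  - move=> P _; rewrite lee_fin le_eqVlt => /predU1P[y0|y0].
      by move: P A0; rewrite -y0 mule0 => -[<-]; rewrite ltxx.
    by move: P; rewrite gt0_mulye ?lte_fin.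
split=> //; last by rewrite mulr_gt0// powR_gt0.
have cE : c `^ (1 - theta) * c `^ theta = c.
  rewrite -powRD; last by rewrite (gt_eqF c0) implybT.
  by rewrite subrK powRr1// ltW.
rewrite /A -[in RHS]cE; ring.
Qed.

(** The kernel integral cancels in the difference of 2F1 and [C], which leaves
    [(1 + c)^-1 - c * beta * T], a number between 0 and 1. For [c = gamma0] this gives
    [-1 <= C3 <= 0]. *)
Lemma GammaM_hyp2F1_bounds (c : R) : 0 < c ->
  let C := Gamma (1 - theta) * Gamma (1 + theta) * c `^ theta in
  0 < C /\ C <= hyp2F1 (- theta) 1 (1 - theta) (- c) <= 1 + C.
Proof.
move=> c0 C; have [T [CE C0 T0 Tc]] := GammaM_reflection c0.
split=> //; rewrite (hyp2F1_euler theta01 0); last by rewrite oppr_le0 ltW.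
rewrite /euler_hyp2F1 expr1 mul1r -/beta opprK /C CE.
have c1 : (1 + c)^-1 <= 1 by rewrite invf_le1 ?lerDl ?addr_gt0// ltW.
have : 0 <= c * beta * T by rewrite !mulr_ge0// ltW.
by move=> cT0; apply/andP; split; lra.
Qed.

End Reflection.

(** * Caching probabilities *)

Section CachingGap.
Context {R : realType}.

Lemma zipf_gt0 (delta : R) Nf (i : 'I_Nf) : 0 < zipf delta i.
Proof.
rewrite divr_gt0 ?powR_gt0 ?ltr0n// (bigD1 i)//= ltr_pwDl ?powR_gt0 ?ltr0n//.
by apply: sumr_ge0 => j _; exact: powR_ge0.
Qed.

Lemma zipf_decreasing (delta : R) Nf (i j : 'I_Nf) : 0 < delta -> (i < j)%N ->
  zipf delta j < zipf delta i.
Proof.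
move=> d0 ij; rewrite ltr_pM2r.
  rewrite !powRN ltf_pV2 ?posrE ?powR_gt0 ?ltr0n//.
  by apply: gt0_ltr_powR => //; rewrite ?nnegrE ?ler0n ?ltr_nat.
(* It remains that the inverse of the normalizing sum is positive, which is read off from the
   positive product [zipf delta i]. *)
have := zipf_gt0 delta i; rewrite /zipf => h.
by rewrite -(pmulr_rgt0 _ (powR_gt0 (- delta) (ltr0Sn R i))).
Qed.

Lemma clip01_ge0 (x : R) : 0 <= clip01 x.
Proof. by rewrite le_max lexx orbT. Qed.

(** A positive total makes some coordinate positive. This sum multiplies [rho] in [active_prob], so
    its sign makes that probability strictly increasing. *)
Lemma load_gt0 (k delta mu : R) Nf Nc : 0 < k -> (0 < Nc)%N ->
  let q : 'rV[R]_Nf := qo k delta mu Nf in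
  \sum_i q 0 i = Nc%:R -> 0 < \sum_i zipf delta i * q 0 i / (k + q 0 i).
Proof.
move=> k0 Nc0 q qN.
have q0 i : 0 <= q 0 i by rewrite mxE clip01_ge0.
have F0 i : 0 <= zipf delta i * q 0 i / (k + q 0 i).
  apply: divr_ge0; first by apply: mulr_ge0 => //; exact/ltW/zipf_gt0.
  by apply: addr_ge0 => //; exact: ltW.
have [i qi] : exists i, 0 < q 0 i.
  apply: contrapT => /forallNP H.
  have : \sum_i q 0 i <= 0.
    by apply: sumr_le0 => i _; rewrite leNgt; exact/negP.
  by rewrite qN leNgt ltr0n Nc0.
rewrite (bigD1 i)//= ltr_pwDl ?sumr_ge0//.
by apply: divr_gt0; [apply: mulr_gt0 => //; exact: zipf_gt0|exact: addr_gt0].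
Qed.

Lemma active_prob_itv (k delta : R) Nf (q : 'rV[R]_Nf) rho :
  0 < \sum_i zipf delta i * q 0 i / (k + q 0 i) -> 0 < rho ->
  0 < active_prob k delta q rho < 1.
Proof.
rewrite /active_prob; set s := \sum_i _ => s0 r0.
have b1 : 1 < 1 + rho / (7 / 2) * s by rewrite ltrDl mulr_gt0// divr_gt0.
have b0 : 0 < 1 + rho / (7 / 2) * s by exact: lt_trans b1.
rewrite gtrBl powR_gt0// andbT subr_gt0 powRN invf_lt1 ?powR_gt0//.
rewrite [ltLHS](_ : 1 = 1 `^ (7 / 2)); last by rewrite powR1.
by apply: gt0_ltr_powR => //; rewrite nnegrE// ltW.
Qed.

Lemma active_prob_increasing (k delta : R) Nf (q : 'rV[R]_Nf) rho1 rho2 :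
  0 < \sum_i zipf delta i * q 0 i / (k + q 0 i) -> 0 < rho1 -> rho1 < rho2 ->
  active_prob k delta q rho1 < active_prob k delta q rho2.
Proof.
rewrite /active_prob; set s := \sum_i _ => s0 r1 r12.
have b rho : 0 < rho -> 0 < 1 + rho / (7 / 2) * s.
  by move=> r0; rewrite addr_gt0// mulr_gt0// divr_gt0.
have r2 : 0 < rho2 by exact: lt_trans r12.
rewrite ltrD2l ltrN2 !powRN ltf_pV2 ?posrE ?powR_gt0 ?b//.
apply: gt0_ltr_powR; rewrite // ?nnegrE ?(ltW (b _ _))//.
by rewrite ltrD2l ltr_pM2r// ltr_pM2r// invr_gt0.
Qed.

(** Brings the objective, up to a factor independent of [q], to the form with a single shift [t]. *)
Lemma Poff_lbE (c1 c2 c3 pa delta : R) Nf (q : 'rV[R]_Nf) : pa * c3 + 1 != 0 ->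
  Poff_lb c1 c2 c3 pa delta q = (pa * c3 + 1)^-1 *
    \sum_i zipf delta i * q 0 i / ((c1 + pa * c2) / (pa * c3 + 1) + q 0 i).
Proof.
move=> d0; rewrite mulr_sumr; apply: eq_bigr => i _.
rewrite [RHS]mulrC -[RHS]mulrA -invfM; congr (_ * _^-1).
by rewrite [RHS]mulrDl divfK// [q 0 i * _]mulrC.
Qed.

Lemma maximizes_scale (T : Type) (S : set T) (P Q : T -> R) (a : R) x :
  0 < a -> (forall y, P y = a * Q y) -> maximizes S P x -> maximizes S Q x.
Proof.
move=> a0 PQ [Sx Px]; split=> // y /Px.
by rewrite !PQ ler_pM2l.
Qed.

(** Cross-multiplication leaves [(s2 - s1) * (c2 - c1 * c3)], positive since [c3 <= 0]; the bounds
    [c3 >= -1] and [s2 < 1] keep the denominators positive. *)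
Lemma shift_increasing (c1 c2 c3 s1 s2 : R) : 0 < c1 -> 0 < c2 ->
  -1 <= c3 <= 0 -> 0 < s1 -> s1 < s2 -> s2 < 1 ->
  (c1 + s1 * c2) / (s1 * c3 + 1) < (c1 + s2 * c2) / (s2 * c3 + 1).
Proof.
move=> c10 c20 /andP[c3m c30] s10 s12 s21.
have d s : 0 < s -> s < 1 -> 0 < s * c3 + 1.
  by move=> s0 s1'; have : s * -1 <= s * c3 by [rewrite ler_pM2l]; lra.
have d1 : 0 < s1 * c3 + 1 by apply: d => //; lra.
have d2 : 0 < s2 * c3 + 1 by apply: d => //; lra.
rewrite ltr_pdivrMr// mulrAC ltr_pdivlMr// -subr_gt0.
rewrite (_ : _ - _ = (s2 - s1) * (c2 - c1 * c3)); last by ring.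
rewrite mulr_gt0 ?subr_gt0//.
by have := mulr_ge0_le0 (ltW c10) c30; lra.
Qed.

End CachingGap.

(** * Monotonicity of the caching gap in the density ratio *)

Theorem corollary3 (R : realType)
    (lambda12 P12 B12 gamma0 alpha delta : R) (M1 M2 Nf Nc : nat)
    (hlambda12 : 0 < lambda12) (hP12 : 0 < P12) (hB12 : 0 < B12)
    (hgamma0 : 0 < gamma0) (halpha : 2 < alpha) (hdelta : 0 < delta)
    (hM1 : (1 <= M1)%N) (hM2 : M2 = 1%N)
    (hNc : (1 <= Nc)%N) (hNcNf : (Nc <= Nf)%N)
    (mu : R) (hmu : 0 < mu) :
  let k := macro_weight alpha lambda12 P12 B12 in
  let q2o : 'rV[R]_Nf := qo k delta mu Nf in
  let pa := active_prob k delta q2o in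
  let Poff (rho : R) (q : 'rV[R]_Nf) : R :=
    Poff_lb (C1 alpha lambda12 P12 B12 gamma0 M1 M2) (C2 alpha gamma0 M2)
      (C3 alpha gamma0 M2) (pa rho) delta q in
  forall (hq2o : \sum_i q2o 0 i = Nc%:R)
    (* rho ranges over the values of lambda_u / lambda_2 *)
    (qstar : R -> 'rV[R]_Nf)
    (hqstar : forall rho, 0 < rho ->
       maximizes (caching_policies Nf Nc) (Poff rho) (qstar rho))
    (f f' : 'I_Nf) (hf : f' = f.+1 :> nat),
  let S : set R :=
    [set rho | [/\ 0 < rho, 0 < qstar rho 0 f < 1 & 0 < qstar rho 0 f' < 1]] in
  forall rho1 rho2, S rho1 -> S rho2 -> rho1 < rho2 ->
    qstar rho1 0 f - qstar rho1 0 f' < qstar rho2 0 f - qstar rho2 0 f'.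
Proof.
move=> k q2o pa Poff hq2o qstar hqstar f f' hf S rho1 rho2
  [rho10 q1f q1f'] [rho20 q2f q2f'] rho12.
subst M2; case: M1 hM1 @Poff hqstar @S => // m _ Poff hqstar S.
pose theta := 2 / alpha.
have alpha0 : 0 < alpha by lra.
have theta01 : 0 < theta < 1.
  by rewrite /theta divr_gt0//= ltr_pdivrMr// mul1r.
have k0 : 0 < k by rewrite mulr_gt0// powR_gt0// mulr_gt0.
pose c1 := C1 alpha lambda12 P12 B12 gamma0 m.+1 1.
pose c2 := C2 alpha gamma0 1.
pose c3 := C3 alpha gamma0 1.
have c10 : 0 < c1.
  rewrite /c1 /C1 mulr_gt0//; apply: (hyp2F1_gt0 theta01).
  by rewrite oppr_le0 divr_ge0 ?mulr_ge0 ?divr_ge0 ?ler0n// ltW.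
have [C0 /andP[C1h C2h]] := GammaM_hyp2F1_bounds theta01 hgamma0.
(* For [M2 = 1] the denominator [Gamma 1] equals 1, so [c2] is the constant bounded just above. *)
have c2E : c2 = Gamma (1 - theta) * Gamma (1 + theta) * gamma0 `^ theta.
  by rewrite /c2 /C2 -/theta Gamma1 divr1.
have c20 : 0 < c2 by rewrite c2E.
have c3b : -1 <= c3 <= 0.
  rewrite /c3 /C3 -/theta -/c2; move: C1h C2h; rewrite -c2E => h1 h2.
  by apply/andP; split; lra.
have s0 := load_gt0 k0 hNc hq2o.
have pa01 rho : 0 < rho -> 0 < pa rho < 1 by exact: active_prob_itv.
pose A rho := c1 + pa rho * c2; pose E rho := pa rho * c3 + 1.
have E0 rho : 0 < rho -> 0 < E rho.
  move=> /pa01/andP[p0 p1]; have /andP[c3m _] := c3b.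
  by have : pa rho * -1 <= pa rho * c3 by [rewrite ler_pM2l]; rewrite /E; lra.
have A0 rho : 0 < rho -> 0 < A rho.
  by move=> /pa01/andP[p0 p1]; rewrite addr_gt0// mulr_gt0.
(* Since [E rho] is positive, rescaling the objective preserves its maximizers, and the shift is
   [A rho / E rho]. *)
have max rho : 0 < rho -> maximizes (caching_policies Nf Nc)
    (fun q => \sum_i zipf delta i * q 0 i / (A rho / E rho + q 0 i)) (qstar rho).
  move=> r0; apply: (maximizes_scale (a := (E rho)^-1) _ _ (hqstar rho r0)).
    by rewrite invr_gt0 E0.
  by move=> q; apply: Poff_lbE; rewrite gt_eqF//; exact: E0.
have := @maximizer_gap_increasing _ _ Nc _ (@zipf_gt0 _ delta Nf)
  (A rho1 / E rho1) (A rho2 / E rho2) (qstar rho1) (qstar rho2) f f'.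
apply => //.
- by rewrite divr_gt0 ?A0 ?E0.
- apply: shift_increasing => //.
  + by have /andP[] := pa01 _ rho10.
  + exact: active_prob_increasing.
  + by have /andP[] := pa01 _ rho20.
- by apply: zipf_decreasing => //; rewrite hf.
- exact: max.
- exact: max.
Qed.
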